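(* Let $X$ be the toric variety of a fan $\Sigma$ in a tropical torus $\mathfrak T$, with big torus $T$, let $c=(J,\pi,\omega)$ be a tangency condition with associated tropical degree $\Delta=\Delta(c)$, let $I$ be a finite nonempty set disjoint from $J$, let $L_0=I\cup J$, and fix $i_0\in I$ (used for the torus embeddings). For every $i\in I$ the diagram $$\begin{array}{ccc}M^{\mathrm{lab}}_{0,I}(X,c)&\xrightarrow{\ \operatorname{ev}_i\ }&T\\ {\scriptstyle\operatorname{trop}}\downarrow&&\downarrow{\scriptstyle\operatorname{trop}}\\ \mathfrak M^{\mathrm{lab}}_{0,I}(\mathfrak T,\Delta)&\xrightarrow{\ \mathfrak{ev}_i\ }&\mathfrak T\end{array}$$ is commutative. Furthermore, the evaluation morphisms $\operatorname{ev}_i$ can be extended to morphisms $\overline{\operatorname{ev}}_i:\mathbb G_m^{D(L_0)}/\mathbb G_m^{L_0}\times T\to T$ of algebraic tori.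
   Context: Ground field: $(K,\nu)$ is an algebraically closed valued field of characteristic $0$ (valuation possibly trivial). For a set $S$, $D(S)$ is the set of ordered pairs of distinct elements of $S$. A tropical torus is a finite-dimensional real vector space $\mathfrak T$ with a lattice $N_{\mathfrak T}$ with $N_{\mathfrak T}\otimes\mathbb R=\mathfrak T$; the tropicalization of an algebraic torus with character lattice $M'$ is $\operatorname{Hom}(M',\mathbb R)$, and $\operatorname{trop}$ sends a $K$-point $x$ to $m\mapsto\nu(m(x))$. Toric setting: $\Sigma$ is a rational polyhedral strongly convex fan in $\mathfrak T$ whose rays span $\mathfrak T$; $\Sigma$ consists only of its rays $\Sigma(1)$ and $\{0\}$. $X=X_\Sigma$ is the (smooth) toric variety over $K$ with big torus $T$ (one-parameter subgroup lattice $N_{\mathfrak T}$), $D_\rho$ the boundary divisor of $\rho\in\Sigma(1)$, $u_\rho$ the primitive lattice vector of $\rho$. A tangency condition is $c=(J,\pi,\omega)$ with $J$ a finite set, $\pi:J\to\Sigma(1)$, $\omega:J\to\mathbb N_{>0}$ such that $\sum_\rho d_\rho(c)u_\rho=0$, where $d_\rho(c)=\sum_{j\in\pi^{-1}\{\rho\}}\omega(j)$. Its tropical degree is $\Delta(c):J\to N_{\mathfrak T}$, $j\mapsto\omega(j)u_{\pi(j)}$. It is assumed that $|L_0|\ge3$. Algebraic curves: a labeled parametrized $I$-marked rational curve in $X$ satisfying $c$ is $(C,(p_\lambda)_{\lambda\in L_0},f)$ with $C\cong\mathbb P^1$, distinct points $p_\lambda\in C$, and a morphism $f:C\to X$ whose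 image is not contained in the boundary, such that $f^*(D_\rho)=\sum_{\lambda\in\pi^{-1}\{\rho\}}\omega(\lambda)p_\lambda$ for all $\rho\in\Sigma(1)$. $M^{\mathrm{lab}}_{0,I}(X,c)$ is the set of isomorphism classes, and $\operatorname{ev}_i$ ($i\in I$) sends the curve to $f(p_i)\in T$. Such a curve is determined by the points $(p_\lambda)$ and $f(p_{i_0})\in T$. The torus embedding: write $C=\mathbb P^1$, $p_\lambda=(b_\lambda:a_\lambda)$; the class of the curve is sent to $\bigl([(b_\lambda a_\mu-a_\lambda b_\mu)_{(\lambda,\mu)}],f(p_{i_0})\bigr)\in\mathbb G_m^{D(L_0)}/\mathbb G_m^{L_0}\times T$, where $(x_\lambda)\in\mathbb G_m^{L_0}$ acts through $(x_\lambda x_\mu)_{(\lambda,\mu)}$. $M^{\mathrm{lab}}_{0,I}(X,c)$ is identified with its image. Tropical curves: an abstract rational tropical curve is a finite metric tree $\mathfrak C=(V,E,\ell)$, $\ell:E\to\mathbb R_{>0}\cup\{\infty\}$, without $2$-valent vertices and not consisting of exactly two vertices, such that the edges of infinite length are exactly those incident to a $1$-valent vertex (''legs''; the $1$-valent vertices are ''feet'', other vertices ''inner''); $\mathfrak C^\circ$ is $\mathfrak C$ without the feet. $\mathfrak M^{\mathrm{lab}}_{0,I}(\mathfrak T,\Delta)$ is the set of isomorphism classes of triples $(\mathfrak C,(e_\lambda)_{\lambda\in L_0},\mathfrak f)$, where $\lambda\mapsto e_\lambda$ is a bijection from $L_0$ to the legs of $\mathfrak C$ and $\mathfrak f:\mathfrak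 C^\circ\to\mathfrak T$ is continuous and affine linear on edges, with all direction vectors $\mathrm v(v,e)$ (derivative of $\mathfrak f|_e$ in the direction away from the inner vertex $v\in e$, with respect to length) in $N_{\mathfrak T}$, balanced ($\sum_{e\ni v}\mathrm v(v,e)=0$ at each inner vertex $v$), with direction $\Delta(j)$ on $e_j$ for $j\in J$ and direction $0$ on $e_i$ for $i\in I$. $\mathfrak{ev}_i$ ($i\in I$) sends such a curve to the point $\mathfrak f(e_i)$. Let $\operatorname{dist}_{\mathfrak C}(\lambda,\mu)$ be the distance between the inner vertices incident to $e_\lambda,e_\mu$, $\Phi:\mathbb R^{L_0}\to\mathbb R^{D(L_0)}$, $(x_\lambda)\mapsto(x_\lambda+x_\mu)_{(\lambda,\mu)}$, and $\mathfrak{pl}(\mathfrak C)=[(-\operatorname{dist}_{\mathfrak C}(\lambda,\mu)/2)_{(\lambda,\mu)}]\in\mathbb R^{D(L_0)}/\operatorname{Im}\Phi$. The injective map $\mathfrak{pl}\times\mathfrak{ev}_{i_0}$ identifies $\mathfrak M^{\mathrm{lab}}_{0,I}(\mathfrak T,\Delta)$ with a subset of $\mathbb R^{D(L_0)}/\operatorname{Im}\Phi\times\mathfrak T$, the tropicalization of $\mathbb G_m^{D(L_0)}/\mathbb G_m^{L_0}\times T$. The left vertical map is the restriction of $\operatorname{trop}$ of the latter torus. *)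

(* Defs.v *)
From HB Require Import structures.
From mathcomp Require Import all_boot all_order all_algebra.
From mathcomp Require Import boolp classical_sets reals constructive_ereal.

Set Implicit Arguments.
Unset Strict Implicit.
Unset Printing Implicit Defensive.

Import Order.TTheory GRing.Theory Num.Theory.
Local Open Scope ring_scope.
Local Open Scope quotient_scope.

(* A real valuation. The value at 0 (usually +oo) is left unspecified: no axiom
   mentions it, and only values at nonzero elements are used below. *)
Record valuation (K : fieldType) (R : realType) := Valuation {
  val_fun :> K -> R;
  valM : forall x y, x != 0 -> y != 0 -> val_fun (x * y) = val_fun x + val_fun y;
  valD : forall x y, x != 0 -> y != 0 -> x + y != 0 ->
    Num.min (val_fun x) (val_fun y) <= val_fun (x + y)
}.

Section Lattice.
Variables (R : realType) (V : vectType R).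

(* A tropical torus is a pair (V, N) with N a lattice in V. *)
Definition is_lattice (N : set V) : Prop :=
  exists (n : nat) (b : n.-tuple V), basis_of fullv b /\
    forall x, N x <-> exists c : 'I_n -> int, x = \sum_(k < n) tnth b k *~ c k.

Definition primitive (N : set V) (u : V) : Prop :=
  [/\ N u, u != 0 & forall v k, N v -> u = v *+ k -> k = 1%N].

(* The character lattice Hom(N, Z), realized as the group of linear forms on V
   that take integral values on N. *)
Definition integral_forms (N : set V) : {pred 'Hom(V, R^o)} :=
  [pred m : 'Hom(V, R^o) | `[< forall x, N x -> (m x : R) \is a Num.int >]].

Fact integral_forms_zmod N : zmod_closed (integral_forms N).
Proof.
split=> [|m n /asboolP Hm /asboolP Hn]; apply/asboolP => x Nx.
  by rewrite zero_lfunE rpred0.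
by rewrite add_lfunE opp_lfunE rpredB ?Hm ?Hn.
Qed.
HB.instance Definition _ N :=
  GRing.isZmodClosed.Build _ (integral_forms N) (integral_forms_zmod N).

Record charlat (N : set V) := Charlat {
  char_form :> 'Hom(V, R^o);
  char_int : char_form \in integral_forms N
}.
HB.instance Definition _ N := [isSub for @char_form N].
HB.instance Definition _ N := [Choice of charlat N by <:].
HB.instance Definition _ N := [SubChoice_isSubZmodule of charlat N by <:].

Lemma char0E (N : set V) x : ((0 : charlat N) x : R) = 0.
Proof. by rewrite [char_form _](raddf0 (val : charlat N -> _)) zero_lfunE. Qed.
Lemma charDE (N : set V) (m n : charlat N) x : ((m + n) x : R) = m x + n x.
Proof. by rewrite [char_form _](raddfD (val : charlat N -> _)) add_lfunE. Qed.
Lemma charNE (N : set V) (m : charlat N) x : ((- m) x : R) = - (m x : R).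
Proof. by rewrite [char_form _](raddfN (val : charlat N -> _)) opp_lfunE. Qed.
Lemma charMnE (N : set V) (m : charlat N) x k : ((m *+ k) x : R) = m x *+ k.
Proof. by elim: k => [|k IH]; rewrite ?mulr0n ?char0E // !mulrS charDE IH. Qed.
Lemma charMzE (N : set V) (m : charlat N) x k : ((m *~ k) x : R) = m x *~ k.
Proof. by case: k => k; rewrite ?NegzE ?mulrNz ?charNE -?pmulrn charMnE. Qed.

(* V is identified with Hom(charlat N, R), the tropicalization of the algebraic
   torus with character lattice charlat N. *)
Definition tpoint (N : set V) (t : V) : charlat N -> R := fun m => m t.

(* A fan whose cones are {0} and the rays spanned by the u_rho, which are the
   primitive generators of its rays. *)
Record ray_fan (N : set V) := RayFan {
  rays :> finType;
  ray_gen : rays -> V;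
  ray_gen_prim : forall r, primitive N (ray_gen r);
  ray_gen_inj : injective ray_gen;
  ray_gen_span : <<[seq ray_gen r | r in rays]>>%VS = fullv
}.

Section Fan.
Variables (N : set V) (S : ray_fan N).

(* The cones of the fan are indexed by option S, with None for the cone {0}. *)
Definition cone (s : option S) : set V :=
  if s is Some r then [set x | exists2 a : R, 0 <= a & x = a *: ray_gen r]%classic
  else [set 0]%classic.

Definition cone_cap (s t : option S) : option S := if s == t then s else None.

Definition dual_monoid (s : option S) : set (charlat N) :=
  [set m | forall x, cone s x -> 0 <= (m x : R)]%classic.

Lemma dual_monoidNone (m : charlat N) : dual_monoid None m.
Proof. by move=> x ->; rewrite linear0. Qed.

Lemma dual_monoidSome r (m : charlat N) :
  dual_monoid (Some r) m <-> 0 <= (m (ray_gen r) : R).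
Proof.
split=> [|m_ge0 x [a a_ge0 ->]]; last by rewrite linearZ mulr_ge0.
by apply; exists 1; rewrite ?scale1r.
Qed.

Record tangency (J : finType) := Tangency {
  tc_ray : J -> S;
  tc_mult : J -> nat;
  tc_mult_gt0 : forall j, (0 < tc_mult j)%N;
  tc_balanced :
    \sum_(r : S) ray_gen r *+ (\sum_(j | tc_ray j == r) tc_mult j)%N = 0
}.

Definition tdegree (J : finType) (c : tangency J) (j : J) : V :=
  ray_gen (tc_ray c j) *+ tc_mult c j.

End Fan.
End Lattice.

Section Torus.
Variables (K : fieldType) (R : realType) (V : vectType R) (N : set V).

(* K-points of the torus T with character lattice charlat N. Such a
   homomorphism has nonzero values. *)
Record torus_pt := TorusPt {
  torus_fun :> charlat N -> K;
  torus0 : torus_fun 0 = 1;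
  torusD : forall m n, torus_fun (m + n) = torus_fun m * torus_fun n
}.

Lemma torus_neq0 (t : torus_pt) m : t m != 0.
Proof.
apply/eqP => tm0; have := torusD t m (- m).
by rewrite subrr torus0 tm0 mul0r => /eqP; rewrite oner_eq0.
Qed.

Fact torus_mul0 (s t : torus_pt) : s 0 * t 0 = 1.
Proof. by rewrite !torus0 mulr1. Qed.
Fact torus_mulD (s t : torus_pt) m n :
  s (m + n) * t (m + n) = (s m * t m) * (s n * t n).
Proof. by rewrite !torusD mulrACA. Qed.
Definition torus_mul (s t : torus_pt) : torus_pt :=
  @TorusPt (fun m => s m * t m) (torus_mul0 s t) (torus_mulD s t).

Definition torus_trop (nu : valuation K R) (t : torus_pt) : charlat N -> R :=
  fun m => nu (t m).

End Torus.

(* K-points of the toric variety: the gluing of the affine charts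
   U_s = Spec K[dual_monoid s] along U_(cone_cap s t). *)
Section ToricVariety.
Variables (K : fieldType) (R : realType) (V : vectType R) (N : set V).
Variable S : ray_fan N.

(* z restricts to a K-point of U_s, i.e. to a monoid homomorphism from
   the multiplicative monoid K. The values of z off dual_monoid s are irrelevant:
   [glue] below identifies functions that agree on dual_monoid s. *)
Definition semihom (s : option S) (z : charlat N -> K) : Prop :=
  z 0 = 1 /\ forall m n, dual_monoid s m -> dual_monoid s n ->
    z (m + n) = z m * z n.

Record chart_pt := ChartPt {
  cpt_cone : option S;
  cpt_fun : charlat N -> K;
  cpt_hom : semihom cpt_cone cpt_fun
}.
HB.instance Definition _ := gen_eqMixin chart_pt.
HB.instance Definition _ := gen_choiceMixin chart_pt.

Definition glue (x y : chart_pt) : Prop :=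
  exists z, [/\ semihom (cone_cap (cpt_cone x) (cpt_cone y)) z,
    forall m, dual_monoid (cpt_cone x) m -> z m = cpt_fun x m
  & forall m, dual_monoid (cpt_cone y) m -> z m = cpt_fun y m].

Lemma glue_refl x : glue x x.
Proof. by exists (cpt_fun x); split=> //; rewrite /cone_cap eqxx; case: x. Qed.

Lemma glue_sym x y : glue x y -> glue y x.
Proof.
case=> z [hz zx zy]; exists z; split=> //; move: hz; rewrite /cone_cap eq_sym.
by case: eqP => // ->.
Qed.

Lemma semihom_None_ext (s : option S) z w : semihom None z -> semihom None w ->
  (forall m, dual_monoid s m -> z m = w m) -> z =1 w.
Proof.
move=> [z0 zD] [w0 wD] zw m; case: s zw => [r|] zw; last first.
  by apply: zw; exact: dual_monoidNone.
have [m_ge0|m_lt0] := lerP 0 (m (ray_gen r) : R).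
  by apply: zw; apply/dual_monoidSome.
have zwN : z (- m) = w (- m).
  apply: zw; apply/dual_monoidSome.
  by rewrite charNE oppr_ge0 ltW.
have zm := zD m (- m) (dual_monoidNone _) (dual_monoidNone _).
have wm := wD m (- m) (dual_monoidNone _) (dual_monoidNone _).
move: zm wm; rewrite subrr z0 w0 -zwN => zm wm.
have nz : z (- m) != 0.
  by apply/eqP => z0'; move/eqP: zm; rewrite z0' mulr0 oner_eq0.
by apply: (mulIf nz); rewrite -zm -wm.
Qed.

Lemma glue_trans x y w : glue x y -> glue y w -> glue x w.
Proof.
case: x y w => [s x hx] [t y hy] [r w hw]; rewrite /glue /= /cone_cap.
case=> z [hz zx zy] [z' [hz' zy' zw]].
case: eqP hz => [st|st] hz; case: eqP hz' => [tr|tr] hz'.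
- subst t r; exists x; rewrite eqxx; split=> // m Sm.
  by rewrite -zw // zy' // -zy // zx.
- subst t; exists z'; split=> //; first by case: eqP.
  by move=> m Sm; rewrite zy' // -zy // zx.
- subst r; exists z; split=> //; first by case: eqP.
  by move=> m Sm; rewrite zy // -zy' // zw.
have zz' : z =1 z'.
  by apply: (@semihom_None_ext t) => // m Sm; rewrite zy // zy'.
case: eqP => [sr|sr]; last by exists z; split=> // m Sm; rewrite zz' zw.
by subst r; exists x; split=> // m Sm; rewrite -zx // zz' zw.
Qed.

Fact glueb_refl : reflexive (fun x y => `[< glue x y >]).
Proof. by move=> x; apply/asboolP/glue_refl. Qed.
Fact glueb_sym : symmetric (fun x y => `[< glue x y >]).
Proof. by move=> x y; apply/asboolP/asboolP; apply: glue_sym. Qed.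
Fact glueb_trans : transitive (fun x y => `[< glue x y >]).
Proof.
move=> y x z /asboolP xy /asboolP yz.
by apply/asboolP; apply: glue_trans xy yz.
Qed.
Definition glue_equiv := EquivRel (fun x y => `[< glue x y >])
  glueb_refl glueb_sym glueb_trans.

Definition toric := {eq_quot glue_equiv}.

(* x lies in the chart U_s, and m |-> z m are its coordinates there. *)
Definition chart_coords (s : option S) (x : toric) (z : charlat N -> K) : Prop :=
  exists h : semihom s z, x = \pi_toric (ChartPt h).

Fact torus_semihom (t : torus_pt K N) : semihom None t.
Proof. by split=> [|m n _ _]; [exact: torus0|exact: torusD]. Qed.
Definition torus_incl (t : torus_pt K N) : toric :=
  \pi_toric (ChartPt (torus_semihom t)).

Definition boundary (x : toric) : Prop := forall t, x <> torus_incl t.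

End ToricVariety.

Section ProjectiveLine.
Variable K : fieldType.

Definition hcoord := {x : K * K | x != (0, 0)}.

(* For p = (b : a) and q = (b' : a') this is b a' - a b'. *)
Definition bracket (x y : hcoord) : K :=
  (val x).1 * (val y).2 - (val x).2 * (val y).1.
Definition proportional (x y : hcoord) : bool := bracket x y == 0.

Fact proportional_refl : reflexive proportional.
Proof. by move=> x; rewrite /proportional /bracket mulrC subrr. Qed.
Fact proportional_sym : symmetric proportional.
Proof.
move=> x y; rewrite /proportional /bracket -oppr_eq0 opprB.
by rewrite mulrC [_ * (val y).2]mulrC.
Qed.
Fact proportional_trans : transitive proportional.
Proof.
move=> y x z; rewrite /proportional /bracket !subr_eq0.
case: y => -[b a] /= nz; case: (val x) => b1 a1; case: (val z) => b2 a2 /=.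
move=> /eqP xy /eqP yz; have [b0|b0] := eqVneq b 0.
  have a0 : a != 0 by move: nz; rewrite b0 xpair_eqE eqxx.
  by apply/eqP/(mulfI a0); rewrite mulrA [a * b1]mulrC xy -mulrA yz mulrCA.
by apply/eqP/(mulfI b0); rewrite mulrCA yz mulrA xy -mulrA mulrCA.
Qed.
Canonical proportional_equiv := EquivRel proportional
  proportional_refl proportional_sym proportional_trans.

Definition P1 := {eq_quot proportional_equiv}.

Definition hrep (p : P1) : hcoord := repr p.

Lemma bracket_neq0 (p q : P1) : p != q -> bracket (hrep p) (hrep q) != 0.
Proof.
apply: contraNneq => /eqP pq; rewrite -[p]reprK -[q]reprK.
by apply/eqP/eqmodP.
Qed.

(* The binary form sum_k P_k b^k a^(d-k), at the point (b : a). Its value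
   depends on the choice of homogeneous coordinates, but its vanishing and
   quotients of forms of the same degree do not. *)
Definition bform (d : nat) (P : {poly K}) (p : P1) : K :=
  \sum_(k < d.+1) P`_k * (val (hrep p)).1 ^+ k * (val (hrep p)).2 ^+ (d - k).

Definition zopen (U : set P1) : Prop :=
  forall p, U p -> exists d Q, bform d Q p != 0 /\
    forall q, bform d Q q != 0 -> U q.

Definition regular_on (U : set P1) (h : P1 -> K) : Prop :=
  forall p, U p -> exists (W : set P1) d P Q,
    [/\ zopen W, W p, (W `<=` U)%classic
      & forall q, W q -> bform d Q q != 0 /\ h q = bform d P q / bform d Q q].

(* The order of vanishing of h at p is k: near p, h is a unit times the k-th
   power of the linear form vanishing at p. *)
Definition ord_at (p : P1) (h : P1 -> K) (k : nat) : Prop :=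
  exists (W : set P1) d P Q,
    [/\ zopen W, W p, bform d P p != 0
      & forall q, W q -> bform (k + d) Q q != 0 /\
        h q = bracket (hrep p) (hrep q) ^+ k * bform d P q / bform (k + d) Q q].

End ProjectiveLine.

Section AlgebraicCurves.
Variables (K : closedFieldType) (R : realType) (V : vectType R) (N : set V).
Variable S : ray_fan N.

Definition is_morphism (f : P1 K -> toric K S) : Prop :=
  forall p s z, chart_coords s (f p) z ->
    exists (U : set (P1 K)) (g : P1 K -> charlat N -> K),
      [/\ zopen U, U p, forall q, U q -> chart_coords s (f q) (g q)
        & forall m, dual_monoid s m -> regular_on U (g^~ m)].

(* The pullback along f of the Cartier divisor D_r is \sum_p D p * p. On the
   chart of the ray r, D_r is the divisor of any character m with <m, u_r> = 1,
   and D_r is disjoint from the other charts. *)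
Definition pullback_divisor (f : P1 K -> toric K S) (r : S) (D : P1 K -> nat) :
    Prop :=
  forall p,
    (forall z, chart_coords (Some r) (f p) z ->
      exists (U : set (P1 K)) (g : P1 K -> charlat N -> K) (m : charlat N),
        [/\ zopen U, U p, forall q, U q -> chart_coords (Some r) (f q) (g q),
            (m (ray_gen r) : R) = 1 & ord_at p (g^~ m) (D p)])
    /\ (~ (exists z, chart_coords (Some r) (f p) z) -> D p = 0%N).

Variables (I J : finType) (c : tangency S J).

(* Curves are represented with C = P^1, and L_0 is the disjoint union I + J.
   An isomorphism class is given by any of its representatives. *)
Record alg_curve := AlgCurve {
  mark : I + J -> P1 K;
  mark_inj : injective mark;
  amap : P1 K -> toric K S;
  amap_morphism : is_morphism amap;
  amap_boundary : exists p, ~ boundary (amap p);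
  amap_tangency : forall r : S, pullback_divisor amap r (fun p =>
    \sum_(j | (tc_ray c j == r) && (mark (inr j) == p)) tc_mult c j)%N
}.

Lemma chart_torus (r : S) z (m : charlat N) : semihom (Some r) z ->
  (m (ray_gen r) : R) = 1 -> z m != 0 ->
  exists t : torus_pt K N, forall n, dual_monoid (Some r) n -> t n = z n.
Proof.
move=> [z0 zD] mu zm.
pose k (n : charlat N) : int := Num.floor (n (ray_gen r) : R).
have kE n : ((k n)%:~R : R) = n (ray_gen r).
  apply/eqP; rewrite -intrEfloor; have /asboolP := char_int n.
  by apply; case: (ray_gen_prim r).
have kD n n' : k (n + n') = k n + k n'.
  apply: (@intr_inj R); rewrite intrD !kE.
  by rewrite charDE.
have evZ n (a : int) : ((n - m *~ a) (ray_gen r) : R) = n (ray_gen r) - a%:~R.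
  by rewrite charDE charNE charMzE mu.
have perp n : dual_monoid (Some r) (n - m *~ k n).
  by apply/dual_monoidSome; rewrite evZ kE subrr.
have w0 : z (0 - m *~ k 0) * z m ^ (k 0) = 1.
  have -> : k 0 = 0 by apply: (@intr_inj R); rewrite kE char0E.
  by rewrite mulr0z subrr z0 expr0z mulr1.
have wD n n' : z (n + n' - m *~ k (n + n')) * z m ^ (k (n + n')) =
    (z (n - m *~ k n) * z m ^ k n) * (z (n' - m *~ k n') * z m ^ k n').
  rewrite kD mulrzDr opprD addrACA [in LHS]zD //.
  by rewrite expfzDr // mulrACA.
exists (@TorusPt _ _ _ _ (fun n => z (n - m *~ k n) * z m ^ (k n)) w0 wD) => n Sn /=.
have Sm : dual_monoid (Some r) m by apply/dual_monoidSome; rewrite mu ler01.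
have : 0 <= k n by rewrite -(ler_int R) kE; apply/dual_monoidSome.
case: (k n) (perp n) => // a pa _.
rewrite -[in RHS](subrK (m *~ a) n) -exprnP.
have Sma b : dual_monoid (Some r) (m *+ b) /\ z (m *+ b) = z m ^+ b.
  elim: b => [|b [Sb zb]].
    by split; [apply/dual_monoidSome; rewrite char0E|rewrite z0].
  split; last by rewrite mulrS exprS zD // zb.
  by move=> x cx; rewrite mulrS charDE addr_ge0 ?Sm ?Sb.
by rewrite -pmulrn [in RHS]zD ?(proj2 (Sma a)) //; exact: (proj1 (Sma a)).
Qed.

Lemma inner_mark_torus (C : alg_curve) (i : I) :
  exists t, amap C (mark C (inl i)) = torus_incl S t.
Proof.
set p := mark C (inl i).
have [[s z hz] fp] : exists x, amap C p = \pi_(toric K S) x.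
  by exists (repr (amap C p)); rewrite reprK.
case: s hz fp => [r|] hz fp; last first.
  have [z0 zD] := hz.
  exists (TorusPt z0 (fun m n =>
    zD m n (@dual_monoidNone _ _ _ S m) (@dual_monoidNone _ _ _ S n))).
  rewrite fp; apply/eqmodP/asboolP; exists z.
  by rewrite /cone_cap eqxx; split.
have [/(_ z (ex_intro _ hz fp))[U [g [m [_ Up cg mu ordp]]]] _] :=
  amap_tangency C r p.
have [W [d [P [Q [_ Wp Pp]]]]] := ordp.
rewrite big1 => [WPQ|j /andP[_ /eqP /mark_inj] //].
have [Qp gpm] := WPQ p Wp.
have gpm0 : g p m != 0.
  by rewrite gpm expr0 mul1r mulf_neq0 ?invr_eq0.
have [hg fpg] := cg p Up.
have [t tg] := chart_torus hg mu gpm0; exists t.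
rewrite fpg; apply/eqmodP/asboolP; exists t.
by rewrite /cone_cap /=; split=> //; exact: torus_semihom.
Qed.

Definition ev (C : alg_curve) (i : I) : torus_pt K N :=
  sval (cid (inner_mark_torus C i)).

Lemma evE (C : alg_curve) (i : I) : amap C (mark C (inl i)) = torus_incl S (ev C i).
Proof. exact: svalP (cid (inner_mark_torus C i)). Qed.

End AlgebraicCurves.

(* The torus G_m^D(L) / G_m^L and its tropicalization R^D(L) / Im Phi. *)
Section Pluecker.
Variables (K : fieldType) (R : realType) (L : finType).

Definition dpairs := {d : L * L | d.1 != d.2}.

Definition gm := {x : {ffun dpairs -> K} | [forall d, x d != 0]}.

Fact gm_mul_subproof (x y : gm) :
  [forall d, [ffun e => val x e * val y e] d != 0].
Proof.
apply/forallP => d; rewrite ffunE mulf_neq0 //.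
  exact: (forallP (valP x)).
exact: (forallP (valP y)).
Qed.
Definition gm_mul (x y : gm) : gm :=
  exist (fun z : {ffun dpairs -> K} => [forall d, z d != 0])
    [ffun d => val x d * val y d] (gm_mul_subproof x y).

Definition same_orbit (x y : gm) : Prop :=
  exists2 t : {ffun L -> K}, forall l, t l != 0
    & forall d : dpairs, val y d = t (val d).1 * t (val d).2 * val x d.

Lemma same_orbit_refl x : same_orbit x x.
Proof. by exists [ffun=> 1] => ?; rewrite !ffunE ?oner_eq0 // !mul1r. Qed.
Lemma same_orbit_sym x y : same_orbit x y -> same_orbit y x.
Proof.
case=> t t0 xy; exists [ffun l => (t l)^-1] => [l|d].
  by rewrite ffunE invr_eq0.
by rewrite !ffunE xy -invfM mulKf // mulf_neq0.
Qed.
Lemma same_orbit_trans x y z : same_orbit x y -> same_orbit y z -> same_orbit x z.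
Proof.
case=> t t0 xy [s s0 yz]; exists [ffun l => s l * t l] => [l|d].
  by rewrite ffunE mulf_neq0.
by rewrite !ffunE yz xy mulrA (mulrACA (s _)).
Qed.

Fact same_orbitb_refl : reflexive (fun x y => `[< same_orbit x y >]).
Proof. by move=> x; apply/asboolP/same_orbit_refl. Qed.
Fact same_orbitb_sym : symmetric (fun x y => `[< same_orbit x y >]).
Proof. by move=> x y; apply/asboolP/asboolP; apply: same_orbit_sym. Qed.
Fact same_orbitb_trans : transitive (fun x y => `[< same_orbit x y >]).
Proof.
move=> y x z /asboolP xy /asboolP yz.
by apply/asboolP; apply: same_orbit_trans xy yz.
Qed.
Definition same_orbit_equiv := EquivRel (fun x y => `[< same_orbit x y >])
  same_orbitb_refl same_orbitb_sym same_orbitb_trans.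

Definition pl_torus := {eq_quot same_orbit_equiv}.

Definition Phi (x : {ffun L -> R}) : {ffun dpairs -> R} :=
  [ffun d => x (val d).1 + x (val d).2].
Definition eq_mod_Phi (u v : {ffun dpairs -> R}) : Prop :=
  exists x, v = u + Phi x.

Lemma eq_mod_Phi_refl u : eq_mod_Phi u u.
Proof. by exists 0; apply/ffunP => d; rewrite !ffunE !addr0. Qed.
Lemma eq_mod_Phi_sym u v : eq_mod_Phi u v -> eq_mod_Phi v u.
Proof.
by case=> x ->; exists (- x); apply/ffunP => d; rewrite !ffunE -opprD addrK.
Qed.
Lemma eq_mod_Phi_trans u v w : eq_mod_Phi u v -> eq_mod_Phi v w -> eq_mod_Phi u w.
Proof.
case=> x -> [y ->]; exists (x + y); apply/ffunP => d.
by rewrite !ffunE -addrA (addrACA (x _)).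
Qed.

Fact eq_mod_Phib_refl : reflexive (fun u v => `[< eq_mod_Phi u v >]).
Proof. by move=> x; apply/asboolP/eq_mod_Phi_refl. Qed.
Fact eq_mod_Phib_sym : symmetric (fun u v => `[< eq_mod_Phi u v >]).
Proof. by move=> x y; apply/asboolP/asboolP; apply: eq_mod_Phi_sym. Qed.
Fact eq_mod_Phib_trans : transitive (fun u v => `[< eq_mod_Phi u v >]).
Proof.
move=> y x z /asboolP xy /asboolP yz.
by apply/asboolP; apply: eq_mod_Phi_trans xy yz.
Qed.
Definition eq_mod_Phi_equiv := EquivRel (fun u v => `[< eq_mod_Phi u v >])
  eq_mod_Phib_refl eq_mod_Phib_sym eq_mod_Phib_trans.

Definition pl_trop := {eq_quot eq_mod_Phi_equiv}.

Definition gm_trop (nu : valuation K R) (x : gm) : {ffun dpairs -> R} :=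
  [ffun d => nu (val x d)].
Definition pl_torus_trop (nu : valuation K R) (x : pl_torus) : pl_trop :=
  \pi_pl_trop (gm_trop nu (repr x)).

Lemma pl_torus_tropE nu x : pl_torus_trop nu (\pi_pl_torus x) =
  \pi_pl_trop (gm_trop nu x).
Proof.
apply/eqmodP/asboolP; case: piP => y /eqmodP/asboolP/same_orbit_sym[t t0 yx].
have y0 d : val y d != 0 by exact: (forallP (valP y)).
exists [ffun l => nu (t l)]; apply/ffunP => d.
by rewrite !ffunE yx !valM ?mulf_neq0 // addrC.
Qed.

End Pluecker.

Section Embedding.
Variables (K : closedFieldType) (R : realType) (V : vectType R) (N : set V).
Variables (S : ray_fan N) (I J : finType) (c : tangency S J).

Definition bracket_ffun (C : alg_curve K I c) : {ffun dpairs (I + J)%type -> K} :=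
  [ffun d => bracket (hrep (mark C (val d).1)) (hrep (mark C (val d).2))].

Fact bracket_ffun_neq0 C : [forall d, bracket_ffun C d != 0].
Proof.
apply/forallP => d; rewrite ffunE; apply: bracket_neq0.
by rewrite (inj_eq (@mark_inj _ _ _ _ _ _ _ _ C)); exact: (valP d).
Qed.

Definition bracket_gm (C : alg_curve K I c) : gm K (I + J)%type :=
  exist (fun z : {ffun dpairs (I + J)%type -> K} => [forall d, z d != 0])
    (bracket_ffun C) (bracket_ffun_neq0 C).

Definition embed (i0 : I) (C : alg_curve K I c) :
    pl_torus K (I + J)%type * torus_pt K N :=
  (\pi_(pl_torus K (I + J)%type) (bracket_gm C), ev C i0).

End Embedding.

Section TorusMorphisms.
Variables (K : fieldType) (R : realType) (V : vectType R) (N : set V).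
Variable L : finType.

Definition embed_trop (nu : valuation K R) (x : pl_torus K L * torus_pt K N) :
    pl_trop R L * (charlat N -> R) :=
  (pl_torus_trop nu x.1, torus_trop nu x.2).

(* A homomorphism of algebraic groups from G_m^D(L) / G_m^L x T to T: the
   pullback of each character of T is a regular function, that is, a Laurent
   polynomial in the coordinates of G_m^D(L) x T. *)
Definition is_torus_morphism (phi : pl_torus K L * torus_pt K N -> torus_pt K N) :
    Prop :=
  (forall (x y : gm K L) (s t : torus_pt K N),
     phi (\pi_(pl_torus K L) (gm_mul x y), torus_mul s t) =
     torus_mul (phi (\pi_(pl_torus K L) x, s)) (phi (\pi_(pl_torus K L) y, t))) /\
  (forall m : charlat N, exists (n : nat) (a : 'I_n -> K)
       (e : 'I_n -> dpairs L -> int) (q : 'I_n -> charlat N),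
     forall (x : gm K L) (t : torus_pt K N),
       phi (\pi_(pl_torus K L) x, t) m =
       \sum_(k < n) a k * (\prod_(d : dpairs L) val x d ^ e k d) * t (q k)).

End TorusMorphisms.

Section TropicalCurves.
Variable R : realType.

(* A finite metric tree, given by its vertices and its adjacency relation. *)
Record metric_tree := MetricTree {
  tvert :> finType;
  tadj : rel tvert;
  tadj_sym : symmetric tadj;
  tadj_irr : irreflexive tadj;
  tadj_connected : forall v w, connect tadj v w;
  tadj_acyclic : forall s, ucycle tadj s -> (size s <= 2)%N;
  tlen : tvert -> tvert -> \bar R;
  tlen_sym : forall v w, tadj v w -> tlen v w = tlen w v;
  tlen_gt0 : forall v w, tadj v w -> (0 < tlen v w)%E
}.

Definition valence (C : metric_tree) (v : C) : nat := #|[pred w | tadj v w]|.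

(* An abstract rational tropical curve; its legs are the edges incident to a
   vertex of valence 1, and [inner] vertices are the others. *)
Record abs_curve := AbsCurve {
  abs_tree :> metric_tree;
  abs_no2valent : forall v : abs_tree, valence v != 2%N;
  abs_not2 : #|abs_tree| != 2%N;
  abs_legs : forall v w : abs_tree, tadj v w ->
    tlen v w = +oo%E <-> valence v = 1%N \/ valence w = 1%N
}.

Definition inner (C : metric_tree) (v : C) : bool := valence v != 1%N.

(* The length of the walk v :: p; only used when no edge in it is infinite. *)
Definition walk_length (C : metric_tree) (v : C) (p : seq C) : R :=
  \sum_(e <- zip (v :: p) p) fine (tlen e.1 e.2).

(* The simple path from v to w, which exists and is unique in a tree. *)
Definition geodesic (C : metric_tree) (v w : C) : seq C :=
  xget [::] [set p | [/\ path (@tadj C) v p, uniq (v :: p) & last v p = w]]%classic.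

Definition tdist (C : metric_tree) (v w : C) : R := walk_length v (geodesic v w).

Variables (V : vectType R) (N : set V) (I J : finType) (Delta : J -> V).

(* The leg e_l is the edge joining the inner vertex leg_root l to leg_foot l.
   The map on the curve without its feet is encoded by its values tpos at inner
   vertices and its direction vectors tdir v w at v on the edge v w: on this
   edge it is x |-> tpos v + x *: tdir v w, with x the distance to v. The values
   of tpos and tdir at feet are irrelevant. *)
Record trop_curve := TropCurve {
  tcurve :> abs_curve;
  leg_root : I + J -> tcurve;
  leg_foot : I + J -> tcurve;
  leg_adj : forall l, tadj (leg_root l) (leg_foot l);
  leg_root_inner : forall l, inner (leg_root l);
  leg_foot_inj : injective leg_foot;
  leg_foot_im : forall v, valence v = 1%N <-> exists l, leg_foot l = v;
  tpos : tcurve -> V;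
  tdir : tcurve -> tcurve -> V;
  tdir_int : forall v w, inner v -> tadj v w -> N (tdir v w);
  tpos_affine : forall v w, inner v -> inner w -> tadj v w ->
    tpos w = tpos v + fine (tlen v w) *: tdir v w;
  tdir_balanced : forall v, inner v -> \sum_(w | tadj v w) tdir v w = 0;
  tdir_marked : forall i, tdir (leg_root (inl i)) (leg_foot (inl i)) = 0;
  tdir_unmarked : forall j, tdir (leg_root (inr j)) (leg_foot (inr j)) = Delta j
}.

(* The leg e_i is contracted to a point. *)
Definition tev (C : trop_curve) (i : I) : V := tpos (leg_root C (inl i)).

Definition tpl (C : trop_curve) : pl_trop R (I + J)%type :=
  \pi_(pl_trop R (I + J)%type)
    [ffun d => - tdist (leg_root C (val d).1) (leg_root C (val d).2) / 2].

Definition tembed (i0 : I) (C : trop_curve) :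
    pl_trop R (I + J)%type * (charlat N -> R) :=
  (tpl C, tpoint (tev C i0)).

End TropicalCurves.

(* Main.v *)
(* Algebraic side: for a character m the pullback of m along f is a rational
   function on P^1 with divisor sum_j <m, Delta_j> p_j, hence
     ev_i(m) = ev_i0(m) * prod_j ([p_j p_i] / [p_j p_i0])^<m, Delta_j>
   with brackets [p q] the Pluecker coordinates. The right-hand side makes sense
   on the whole torus, and is invariant under G_m^L0 because sum_j Delta_j = 0.

   Tropical side: v |-> f(v) + 1/2 sum_j dist(p_j, v) Delta_j is harmonic on the
   inner vertices, hence constant by the maximum principle, so that
     f(i) - f(i0) = sum_j (dist(p_j, i0) - dist(p_j, i)) / 2 * Delta_j;
   this is the valuation of the algebraic formula.

   That trop(C) is a tropical curve: the valuations of the brackets satisfy the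
   four-point condition, which becomes an ultrametric inequality after the leg i0
   is normalized away; the tree is the tree of balls of this ultrametric. *)

Require Import Defs.
From mathcomp Require Import all_boot all_order all_algebra.
From mathcomp Require Import zify ring lra.
From mathcomp Require Import boolp classical_sets reals constructive_ereal.

Set Implicit Arguments.
Unset Strict Implicit.
Unset Printing Implicit Defensive.

Import Order.TTheory GRing.Theory Num.Theory.
Local Open Scope ring_scope.
Local Open Scope quotient_scope.

(** * Binary forms and local homogeneous functions on P^1 *)

Section Forms.
Variable K : closedFieldType.
Implicit Types (p q : P1 K) (f g A B G H : P1 K -> K) (E : set (P1 K)).

(** The divisor argument is run without a function field. A bracket depends on the representatives
    [hrep], so it is not a function on P^1; [unit_at] therefore works with quotients of forms whose
    degrees differ by a prescribed integer. Dividing the pulled-back character by its product of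
    brackets leaves, at every point, a unit of degree 0, because the degrees Delta_j sum to 0;
    algebraic closedness makes it constant. The junk values at the end marks are confined to an
    excluded set on which some nonzero form vanishes.

    On the tropical side, the ultrametric is reversed because valuations of brackets grow as marks
    get closer. A tree of balls has leaves only for singletons, so the leg i0 is restored by placing
    i0 at infinite distance: the whole space is its foot, and the complement of i0 is the inner
    vertex that carries it. Commutativity is shown for every tropical curve with the coordinates of
    trop(C), independently of the one constructed. *)

Definition is_form (d : nat) f : Prop := exists P : {poly K}, f =1 bform d P.

Lemma bform_take d (P : {poly K}) p : bform d (take_poly d.+1 P) p = bform d P p.
Proof. by apply: eq_bigr => k _; rewrite coef_take_poly ltn_ord. Qed.

Lemma bform_finite d (P : {poly K}) p : (val (hrep p)).2 != 0 ->
  bform d P p = (val (hrep p)).2 ^+ d *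
    (take_poly d.+1 P).[(val (hrep p)).1 / (val (hrep p)).2].
Proof.
move=> a0; rewrite -bform_take (horner_coef_wide _ (size_take_poly _ _)) mulr_sumr.
apply: eq_bigr => k _; rewrite expr_div_n.
have -> : (val (hrep p)).2 ^+ d =
    (val (hrep p)).2 ^+ k * (val (hrep p)).2 ^+ (d - k).
  by rewrite -exprD subnKC // -ltnS.
by field; rewrite expf_neq0.
Qed.

Lemma bform_infty d (P : {poly K}) p : (val (hrep p)).2 = 0 ->
  bform d P p = P`_d * (val (hrep p)).1 ^+ d.
Proof.
move=> a0; rewrite /bform big_ord_recr /= a0 subnn expr0 mulr1 big1 ?add0r //.
by move=> k _; rewrite expr0n subn_eq0 leqNgt ltn_ord mulr0.
Qed.

(** [bform] ignores coefficients beyond the degree, but these would leak into the product of the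
    polynomials; hence the truncations. *)
Lemma is_form_mul d e f g : is_form d f -> is_form e g ->
  is_form (d + e) (fun p => f p * g p).
Proof.
move=> [P fP] [Q gQ]; exists (take_poly d.+1 P * take_poly e.+1 Q) => p.
have [sP sQ] := (size_take_poly d.+1 P, size_take_poly e.+1 Q).
rewrite fP gQ -[bform d P p]bform_take -[bform e Q p]bform_take.
move: {f g fP gQ}(take_poly _ P) (take_poly _ Q) sP sQ => {}P {}Q sP sQ.
have [a0|a0] := eqVneq (val (hrep p)).2 0.
  rewrite !bform_infty // exprD mulrACA; congr (_ * _).
  (* At infinity only the top coefficient counts, and in its convolution sum only index [d] survives
     the size bounds. *)
  rewrite coefM (bigD1 (inord d)) //= inordK ?ltnS ?leq_addr // addKn big1 ?addr0 //.
  move=> k; rewrite -val_eqE /= inordK ?ltnS ?leq_addr // => kd.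
  have [kd'|kd'] := ltnP k d; last first.
    rewrite nth_default ?mul0r // (leq_trans sP) //.
    by rewrite ltn_neqAle eq_sym kd.
  rewrite [Q`_ _]nth_default ?mulr0 // (leq_trans sQ) //.
  by rewrite ltn_subRL ltn_add2r.
rewrite !bform_finite // !take_poly_id //; first by rewrite hornerM exprD mulrACA.
apply: leq_trans (size_polyMleq _ _) _.
by rewrite -subn1 leq_subLR add1n -addnS -addSn leq_add.
Qed.

Lemma is_form_const (c : K) : is_form 0 (fun=> c).
Proof.
by exists c%:P => p; rewrite /bform big_ord_recl big_ord0 coefC /= !expr0 !mulr1 addr0.
Qed.

Lemma is_form_add d f g : is_form d f -> is_form d g ->
  is_form d (fun p => f p + g p).
Proof.
move=> [P fP] [Q gQ]; exists (P + Q) => p; rewrite fP gQ /bform -big_split /=.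
by apply: eq_bigr => k _; rewrite coefD !mulrDl.
Qed.

Lemma is_form_scale d (c : K) f : is_form d f -> is_form d (fun p => c * f p).
Proof. exact: is_form_mul (is_form_const c). Qed.

Lemma is_form_bracket p : is_form 1 (fun q => bracket (hrep p) (hrep q)).
Proof.
exists ((val (hrep p)).1%:P - (val (hrep p)).2 *: 'X) => q.
rewrite /bform !big_ord_recl big_ord0 /= !coefB !coefZ !coefX !coefC /bracket /=.
by rewrite /bump /= !expr0 !expr1; ring.
Qed.

Fact aff_neq0 (x : K) : (x, 1) != 0 :> K * K.
Proof. by rewrite xpair_eqE oner_eq0 andbF. Qed.
Definition aff (x : K) : P1 K := \pi_(P1 K) (exist _ (x, 1) (aff_neq0 x) : hcoord K).

Lemma hrep_aff x : (val (hrep (aff x))).2 != 0 /\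
  (val (hrep (aff x))).1 / (val (hrep (aff x))).2 = x.
Proof.
have : \pi_(P1 K) (hrep (aff x)) = aff x by rewrite reprK.
move/eqmodP; rewrite /= /proportional /bracket /= mulr1 subr_eq0.
case: (hrep (aff x)) => -[b a] /= ab /eqP bE.
suff a0 : a != 0 by rewrite bE mulrAC mulfV // mul1r.
by apply: contraNneq ab => a0; rewrite bE a0 mul0r.
Qed.

(** [P + 1] takes only the value 1, so it has no root and, over an algebraically closed field, is
    constant. *)
Lemma closed_infinite (P : {poly K}) : (forall x, P.[x] = 0) -> P = 0.
Proof.
move=> P0; have /size_poly1P[c c0 Pc] : size (P + 1) == 1%N.
  case: eqP => // /eqP/closed_rootP[x].
  by rewrite /root hornerD P0 add0r hornerC oner_eq0.
have := P0 0; have -> : P = c%:P - 1 by rewrite -Pc addrK.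
by rewrite hornerD hornerN !hornerC => /eqP; rewrite subr_eq0 => /eqP ->; rewrite subrr.
Qed.

(** Dehomogenized, this is the absence of zero divisors among polynomials. It expresses the
    irreducibility of P^1: identities between forms extend from a nonempty open set. *)
Lemma form_integral d e f g : is_form d f -> is_form e g ->
  (forall p, f p * g p = 0) -> (forall p, f p = 0) \/ (forall p, g p = 0).
Proof.
move=> [P fP] [Q gQ] fg0.
have /eqP : take_poly d.+1 P * take_poly e.+1 Q = 0.
  apply: closed_infinite => x; have [a0 ax] := hrep_aff x.
  have /eqP := fg0 (aff x).
  rewrite fP gQ !bform_finite // ax hornerM !mulf_eq0 !expf_eq0 (negPf a0) !andbF /=.
  by case/orP=> /eqP ->; rewrite ?mul0r ?mulr0.
rewrite mulf_eq0 => /orP[] /eqP PQ0; [left|right] => p; rewrite ?fP ?gQ -bform_take PQ0.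
  by apply: big1 => k _; rewrite coef0 !mul0r.
by apply: big1 => k _; rewrite coef0 !mul0r.
Qed.

(** Reduce [A / B] to lowest terms on the affine line. The local representations show that numerator
    and denominator have the same roots, and coprimality leaves them none. *)
Lemma form_proportional d A B : is_form d A -> is_form d B ->
  (exists p, B p != 0) ->
  (forall p, exists e (A' B' : P1 K -> K), [/\ is_form e A', is_form e B',
     A' p != 0, B' p != 0 & forall q, A q * B' q = A' q * B q]) ->
  exists c, forall q, A q = c * B q.
Proof.
move=> [P AP] [Q BQ] [p0 Bp0] loc.
pose a := take_poly d.+1 P; pose b := take_poly d.+1 Q.
have b0 : b != 0.
  apply: contraNneq Bp0 => b0; rewrite BQ -bform_take -/b b0.
  by apply/eqP; apply: big1 => k _; rewrite coef0 !mul0r.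
pose g := gcdp a b; pose a0 := a %/ g; pose b0' := b %/ g.
have ag : a = a0 * g by rewrite divpK ?dvdp_gcdl.
have bg : b = b0' * g by rewrite divpK ?dvdp_gcdr.
have g0 : g != 0 by rewrite gcdp_eq0 negb_and b0 orbT.
have cop : coprimep a0 b0' by apply: coprimep_div_gcd; rewrite b0 orbT.
have cross x : exists al be : {poly K},
    [/\ al.[x] != 0, be.[x] != 0 & a0 * be = al * b0'].
  have [e [A' [B' [[P' AP'] [Q' BQ'] A'0 B'0 AB]]]] := loc (aff x).
  exists (take_poly e.+1 P'), (take_poly e.+1 Q').
  have [h0 hx] := hrep_aff x.
  move: A'0 B'0; rewrite AP' BQ' !bform_finite // hx !mulf_eq0 !negb_or.
  move=> /andP[_ ->] /andP[_ ->]; split=> //.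
  apply: (mulIf g0); rewrite mulrAC -ag -[RHS]mulrA -bg.
  apply/eqP; rewrite -subr_eq0; apply/eqP/closed_infinite => y.
  have [k0 ky] := hrep_aff y; have := AB (aff y).
  rewrite AP BQ AP' BQ' !bform_finite // ky -/a -/b.
  rewrite hornerD hornerN !hornerM.
  set u := _.2 ^+ d; set v := _.2 ^+ e => H.
  have uv : u * v != 0 by rewrite mulf_neq0 ?expf_neq0.
  by apply: (mulfI uv); rewrite mulr0 mulrBr mulrACA H; ring.
have noroot (x : K) : ~~ root b0' x.
  apply/negP => bx; have [al [be [al0 be0 E]]] := cross x.
  have ax : root a0 x.
    have /eqP : (a0 * be).[x] = 0 by rewrite E hornerM (rootP bx) mulr0.
    by rewrite hornerM mulf_eq0 (negPf be0) orbF.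
  by have := coprimep_root cop ax; rewrite (rootP bx) eqxx.
have noroota (x : K) : ~~ root a0 x.
  apply/negP => ax; have [al [be [al0 be0 E]]] := cross x.
  have : (al * b0').[x] = 0 by rewrite -E hornerM (rootP ax) mul0r.
  move/eqP; rewrite hornerM mulf_eq0 (negPf al0) /= => bx.
  by have := noroot x; rewrite /root bx.
have const (h : {poly K}) : (forall x, ~~ root h x) -> exists2 k, k != 0 & h = k%:P.
  move=> hr; apply/size_poly1P; case: eqP => // /eqP/closed_rootP[x].
  by rewrite (negPf (hr x)).
have [k k0 ak] := const _ noroota; have [l l0 bl] := const _ noroot.
exists (k / l) => q; rewrite AP BQ -bform_take -/a -[bform d Q q]bform_take -/b.
have -> : a = (k / l) *: b.
  by rewrite ag bg ak bl !mul_polyC scalerA mulfVK.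
by rewrite /bform mulr_sumr; apply: eq_bigr => j _; rewrite coefZ !mulrA.
Qed.

(* [G] is a homogeneous function of degree [e] of the chosen representatives
   that is, off [E], a quotient of binary forms nonvanishing at [p]. *)
Definition unit_at E p (e : int) G : Prop :=
  exists dQ dA dB (Q A B : P1 K -> K),
    [/\ [/\ is_form dQ Q, is_form dA A & is_form dB B],
        [/\ Q p != 0, A p != 0 & B p != 0], dA%:Z = dB%:Z + e
      & forall q, ~ E q -> Q q != 0 -> [/\ A q != 0, B q != 0 & G q = A q / B q]].

Lemma unit_at_eq E p e G H : (forall q, ~ E q -> G q = H q) ->
  unit_at E p e G -> unit_at E p e H.
Proof.
move=> GH [dQ [dA [dB [Q [A [B [fm nz dg ABG]]]]]]].
exists dQ, dA, dB, Q, A, B; split=> // q Eq Qq.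
by rewrite -GH //; apply: ABG.
Qed.

(** [unit_at] wants [A] and [B] nonzero on the whole open set; multiplying [Q] by [A * B] shrinks
    the set until they are. *)
Lemma unit_at_quotient E p (e : int) G dQ dA dB Q A B :
  is_form dQ Q -> is_form dA A -> is_form dB B ->
  Q p != 0 -> A p != 0 -> B p != 0 -> dA%:Z = dB%:Z + e ->
  (forall q, ~ E q -> Q q != 0 -> B q != 0 -> G q = A q / B q) ->
  unit_at E p e G.
Proof.
move=> fQ fA fB Qp Ap Bp dg H.
exists (dQ + (dA + dB))%N, dA, dB, (fun q => Q q * (A q * B q)), A, B.
split=> [|||q Eq]; first by split=> //; do 2?apply: is_form_mul.
- by rewrite !mulf_neq0.
- by [].
by rewrite !mulf_eq0 !negb_or => /and3P[? ? ?]; split=> //; apply: H.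
Qed.

Lemma unit_at1 E p : unit_at E p 0 (fun=> 1).
Proof.
apply: (@unit_at_quotient _ _ _ _ 0 0 0 (fun=> 1) (fun=> 1) (fun=> 1));
  rewrite ?oner_eq0 ?addr0 //; try exact: is_form_const.
by move=> *; rewrite divr1.
Qed.

Lemma unit_atM E p e e' G H : unit_at E p e G -> unit_at E p e' H ->
  unit_at E p (e + e') (fun q => G q * H q).
Proof.
move=> [dQ [dA [dB [Q [A [B [[fQ fA fB] [Qp Ap Bp] dg ABG]]]]]]].
move=> [dQ' [dA' [dB' [Q' [A' [B' [[fQ' fA' fB'] [Qp' Ap' Bp'] dg' ABG']]]]]]].
apply: (unit_at_quotient (is_form_mul fQ fQ') (is_form_mul fA fA')
  (is_form_mul fB fB')); rewrite ?mulf_neq0 //.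
  by rewrite !PoszD dg dg' addrACA.
move=> q Eq; rewrite mulf_eq0 negb_or => /andP[Qq Qq'] _.
have [_ Bq ->] := ABG q Eq Qq; have [_ Bq' ->] := ABG' q Eq Qq'.
by field; rewrite Bq Bq'.
Qed.

Lemma unit_atV E p e G : unit_at E p e G -> unit_at E p (- e) (fun q => (G q)^-1).
Proof.
move=> [dQ [dA [dB [Q [A [B [[fQ fA fB] [Qp Ap Bp] dg ABG]]]]]]].
apply: (unit_at_quotient fQ fB fA) => //; first by rewrite dg addrK.
by move=> q Eq Qq _; have [Aq Bq ->] := ABG q Eq Qq; rewrite invf_div.
Qed.

Lemma unit_atX E p e (k : int) G : unit_at E p e G ->
  unit_at E p (e * k) (fun q => G q ^ k).
Proof.
move=> Gp; have GX (n : nat) : unit_at E p (e * n%:Z) (fun q => G q ^+ n).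
  elim: n => [|n IH]; first by rewrite mulr0; apply: unit_at1.
  rewrite intS mulrDr mulr1; apply: unit_at_eq (unit_atM Gp IH) => q _.
  by rewrite exprS.
case: k => n; first exact: GX.
rewrite NegzE mulrN; apply: unit_at_eq (unit_atV (GX n.+1)) => q _.
by rewrite -exprnN.
Qed.

Lemma unit_at_prod E p (T : Type) (s : seq T) (P : pred T) (e : T -> int)
    (G : T -> P1 K -> K) : (forall t, P t -> unit_at E p (e t) (G t)) ->
  unit_at E p (\sum_(t <- s | P t) e t) (fun q => \prod_(t <- s | P t) G t q).
Proof.
move=> Gp; elim: s => [|t s IH].
  rewrite big_nil; apply: unit_at_eq (unit_at1 E p) => q _; by rewrite big_nil.
rewrite big_cons; case: ifP => Pt.
  apply: unit_at_eq (unit_atM (Gp t Pt) IH) => q _; by rewrite big_cons Pt.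
by apply: unit_at_eq IH => q _; rewrite big_cons Pt.
Qed.

Lemma unit_at_bracket E p p' : p' != p ->
  unit_at E p 1 (fun q => bracket (hrep p') (hrep q)).
Proof.
move=> pp; apply: (@unit_at_quotient _ _ _ _ 0 1 0 (fun=> 1) _ (fun=> 1));
  rewrite ?oner_eq0 //; try exact: is_form_const.
- exact: is_form_bracket p'.
- exact: bracket_neq0.
by move=> *; rewrite divr1.
Qed.

(* Two local representations of G are proportional as forms because forms that
   agree on a nonempty open set are equal; K being algebraically closed,
   a reduced representation then has constant numerator and denominator. *)
Lemma unit_everywhere_const E dZ Z G : is_form dZ Z -> (exists p, Z p != 0) ->
  (forall p, E p -> Z p = 0) -> (forall p, unit_at E p 0 G) ->
  exists c, forall q, ~ E q -> G q = c.
Proof.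
move=> fZ [z Zz] EZ Gloc.
have [dQ [dA [dB [Q [A [B [[fQ fA fB] [Qz Az Bz] dg ABG]]]]]]] := Gloc z.
have {dg} : dA = dB by apply/eqP; rewrite -eqz_nat dg addr0.
move=> dg; rewrite {}dg in fA.
have cross p dQ' dA' Q' A' B' : is_form dQ' Q' -> is_form dA' A' ->
    is_form dA' B' -> Q' p != 0 ->
    (forall q, ~ E q -> Q' q != 0 -> [/\ A' q != 0, B' q != 0 & G q = A' q / B' q]) ->
    forall q, A q * B' q = A' q * B q.
  move=> fQ' fA' fB' Qp' ABG'.
  (* The product of [D] with [Z * Q * Q'] vanishes everywhere: [Z] disposes of [E], while [Q] and
     [Q'] dispose of the points outside the two domains. None of these three is the zero form, so
     [D] is. *)
  pose D q := A q * B' q + - 1 * (A' q * B q).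
  have fD : is_form (dB + dA') D.
    apply: is_form_add; first exact: is_form_mul.
    by apply: is_form_scale; rewrite addnC; apply: is_form_mul.
  have fZQ := is_form_mul fZ (is_form_mul fQ fQ').
  have DZQ q : D q * (Z q * (Q q * Q' q)) = 0.
    have [Eq|Eq] := pselect (E q); first by rewrite EZ // mul0r mulr0.
    have [Q0|Q0] := eqVneq (Q q) 0; first by rewrite Q0 mul0r !mulr0.
    have [Q0'|Q0'] := eqVneq (Q' q) 0; first by rewrite Q0' !mulr0.
    have [_ Bq Gq] := ABG q Eq Q0; have [_ Bq' Gq'] := ABG' q Eq Q0'.
    move: Gq'; rewrite Gq => /eqP; rewrite eqr_div // => /eqP H.
    by rewrite /D mulN1r H subrr mul0r.
  have [D0 q|ZQ0] := form_integral fD fZQ DZQ.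
    by have /eqP := D0 q; rewrite /D mulN1r subr_eq0 => /eqP.
  have [Z0|QQ0] := form_integral fZ (is_form_mul fQ fQ') ZQ0.
    by move: Zz; rewrite Z0 eqxx.
  have [Q0|Q0] := form_integral fQ fQ' QQ0; first by move: Qz; rewrite Q0 eqxx.
  by move: Qp'; rewrite Q0 eqxx.
have [c Ac] : exists c, forall q, A q = c * B q.
  apply: (form_proportional fA fB); first by exists z.
  move=> p; have [dQ' [dA' [dB' [Q' [A' [B' [[fQ' fA' fB'] [Qp' Ap' Bp'] dg ABG']]]]]]] :=
    Gloc p.
  have dg' : dA' = dB' by apply/eqP; rewrite -eqz_nat dg addr0.
  rewrite -dg' in fB'.
  by exists dA', A', B'; split=> //; exact: (cross _ _ _ _ _ _ fQ' fA' fB' Qp' ABG').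
exists c => p Ep.
have [dQ' [dA' [dB' [Q' [A' [B' [[fQ' fA' fB'] [Qp' Ap' Bp'] dg ABG']]]]]]] := Gloc p.
have dg' : dA' = dB' by apply/eqP; rewrite -eqz_nat dg addr0.
rewrite -dg' in fB'.
(* The local quotient at [p] has the same constant [c]: cancel the nonzero form [B] from the cross
   relation. *)
have fD := is_form_add (is_form_scale c fB') (is_form_scale (- 1) fA').
have DB q : (c * B' q + - 1 * A' q) * B q = 0.
  have := cross _ _ _ _ _ _ fQ' fA' fB' Qp' ABG' q; rewrite Ac => H.
  rewrite mulrDl mulrAC H; ring.
have [/(_ p)/eqP|B0] := form_integral fD fB DB.
  rewrite mulN1r subr_eq0 => /eqP H.
  by have [_ Bp ->] := ABG' p Ep Qp'; rewrite -H mulfK.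
by move: Bz; rewrite B0 eqxx.
Qed.

End Forms.

(** * Characters along an algebraic curve *)

Section Tangency.
Variables (R : realType) (V : vectType R) (N : set V) (S : ray_fan N).
Variables (J : finType) (c : tangency S J).
Implicit Types (m n : charlat N).

Lemma tdegree_sum : \sum_j tdegree c j = 0.
Proof.
rewrite -[RHS](tc_balanced c) (partition_big (tc_ray c) predT) //=.
apply: eq_bigr => r _; rewrite -sumrMnr.
by apply: eq_bigr => j /eqP <-.
Qed.

(* The integer [<m, Delta_j>]. *)
Definition pairing m (j : J) : int :=
  Num.floor (m (ray_gen (tc_ray c j)) : R) * (tc_mult c j)%:Z.

Lemma floor_ray (r : S) m :
  (Num.floor (m (ray_gen r) : R))%:~R = m (ray_gen r) :> R.
Proof.
apply/eqP; rewrite -intrEfloor; have /asboolP := char_int m.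
by apply; case: (ray_gen_prim r).
Qed.

Lemma pairingE m j : (pairing m j)%:~R = m (tdegree c j) :> R.
Proof. by rewrite intrM floor_ray raddfMn /= -mulr_natr. Qed.

Lemma pairing0 j : pairing 0 j = 0.
Proof. by apply: (@intr_inj R); rewrite pairingE char0E. Qed.

Lemma pairingD m n j : pairing (m + n) j = pairing m j + pairing n j.
Proof. by apply: (@intr_inj R); rewrite intrD !pairingE charDE. Qed.

Lemma pairing_sum m : \sum_j pairing m j = 0.
Proof.
apply: (@intr_inj R); rewrite raddf_sum /=.
under eq_bigr => j _ do rewrite pairingE.
by rewrite -(raddf_sum (char_form m)) tdegree_sum raddf0.
Qed.

End Tangency.

Section CurveCharacters.
Variables (K : closedFieldType) (R : realType) (V : vectType R) (N : set V).
Variables (S : ray_fan N) (I J : finType) (c : tangency S J).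
Variable C : alg_curve K I c.
Implicit Types (p q : P1 K) (m n : charlat N) (s : option S) (x : toric K S).

Lemma chart_coords_torus s (t : torus_pt K N) z :
  chart_coords s (torus_incl S t) z -> forall m, dual_monoid s m -> z m = t m.
Proof.
move=> [h]/eqmodP/asboolP[w [_ wt wz]] m sm.
exact: etrans (esym (wz m sm)) (wt m (@dual_monoidNone _ _ _ S m)).
Qed.

Lemma torus_incl_inj (t t' : torus_pt K N) :
  torus_incl S t = torus_incl S t' -> t =1 t'.
Proof.
move=> tt' m; apply: (@chart_coords_torus None t' t); last exact: dual_monoidNone.
by rewrite -tt'; exists (torus_semihom S t).
Qed.

Lemma chart_coordsP x : exists s z, chart_coords s x z.
Proof.
by rewrite -[x]reprK; case: (repr x) => s z h; exists s, z, h.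
Qed.

Definition end_mark p : Prop := exists j, p = mark C (inr j).

(** Off the end marks the tangency divisor has order 0, so a local equation of the boundary is
    nonzero there and [chart_torus] applies. *)
Lemma amap_torus p : ~ end_mark p -> exists t, amap C p = torus_incl S t.
Proof.
move=> pj; have [[r|] [z [hz fp]]] := chart_coordsP (amap C p); last first.
  have [z0 zD] := hz.
  exists (TorusPt z0 (fun m n =>
    zD m n (@dual_monoidNone _ _ _ S m) (@dual_monoidNone _ _ _ S n))).
  rewrite fp; apply/eqmodP/asboolP; exists z.
  by rewrite /cone_cap eqxx; split.
have [/(_ z (ex_intro _ hz fp))[U [g [m [_ Up cg mu ordp]]]] _] :=
  amap_tangency C r p.
have [W [d [P [Q [_ Wp Pp]]]]] := ordp.
rewrite big_pred0 => [WPQ|j]; last first.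
  by apply/negP => /andP[_ /eqP jp]; apply: pj; exists j.
have [Qp gpm] := WPQ p Wp.
have gpm0 : g p m != 0 by rewrite gpm expr0 mul1r mulf_neq0 ?invr_eq0.
have [hg fpg] := cg p Up.
have [t tg] := chart_torus hg mu gpm0; exists t.
rewrite fpg; apply/eqmodP/asboolP; exists t.
by rewrite /cone_cap /=; split=> //; exact: torus_semihom.
Qed.

(* The character [m] pulled back along the map of the curve, with a junk value
   where the map leaves the big torus. *)
Definition char_val m p : K :=
  if pselect (exists t, amap C p = torus_incl S t) is left h
  then sval (cid h) m else 1.

Lemma char_valE m p t : amap C p = torus_incl S t -> char_val m p = t m.
Proof.
move=> pt; rewrite /char_val; case: pselect => [h|]; last by case; exists t.
by case: cid => t' /= pt'; apply: torus_incl_inj; rewrite -pt' pt.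
Qed.

Lemma char_val_chart m p s z : ~ end_mark p -> chart_coords s (amap C p) z ->
  dual_monoid s m -> char_val m p = z m.
Proof.
move=> /amap_torus[t pt]; rewrite pt => hz sm.
by rewrite (char_valE _ pt) (chart_coords_torus hz).
Qed.

Lemma char_valD m n p : ~ end_mark p ->
  char_val (m + n) p = char_val m p * char_val n p.
Proof. by move=> /amap_torus[t pt]; rewrite !(char_valE _ pt) torusD. Qed.

Lemma char_valMz m (k : int) p : ~ end_mark p ->
  char_val (m *~ k) p = char_val m p ^ k.
Proof.
move=> /amap_torus[t pt]; rewrite !(char_valE _ pt).
have tX (a : nat) : t (m *+ a) = t m ^+ a.
  by elim: a => [|a IH]; rewrite ?mulr0n ?torus0 // mulrS torusD IH exprS.
case: k => a; first exact: tX.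
rewrite NegzE mulrNz -exprnN.
apply: (mulIf (torus_neq0 t (m *+ a.+1))).
rewrite -torusD addNr torus0 tX mulVf //.
by rewrite expf_neq0 // torus_neq0.
Qed.

(** Passes from arbitrary Zariski open sets to the complement of the zeros of one form: the
    nonvanishing locus of [X] lies in [W]. *)
Lemma regular_unit_at (U : set (P1 K)) p (h G : P1 K -> K) : zopen U -> U p ->
  regular_on U h -> h p != 0 ->
  (forall q, ~ end_mark q -> U q -> G q = h q) -> unit_at end_mark p 0 G.
Proof.
move=> oU Up reg hp Gh; have [W [d [P [Q [oW Wp WU PQ]]]]] := reg p Up.
have [dX [X [Xp XW]]] := oW p Wp; have [Qp hpE] := PQ p Wp.
apply: (@unit_at_quotient _ _ _ _ _ dX d d (bform dX X) (bform d P) (bform d Q));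
  rewrite ?addr0 //; try by eexists.
  by apply: contraNneq hp => Pp; rewrite hpE Pp mul0r.
move=> q Eq Xq _; have Wq := XW q Xq.
by rewrite Gh //; [exact: (PQ q Wq).2|exact: WU].
Qed.

Lemma char_val_unit_at m p : ~ end_mark p -> unit_at end_mark p 0 (char_val m).
Proof.
move=> Ep; have [t pt] := amap_torus Ep.
have ct : chart_coords None (amap C p) t.
  by rewrite pt; exists (torus_semihom S t).
have [U [g [oU Up cg reg]]] := amap_morphism ct.
apply: (regular_unit_at oU Up (reg m (dual_monoidNone _))).
  have cgp := cg p Up; rewrite pt in cgp.
  by rewrite (chart_coords_torus cgp (dual_monoidNone _)) torus_neq0.
move=> q Eq Uq; apply: char_val_chart Eq (cg q Uq) (dual_monoidNone _).
Qed.

(** Write [m] as [n + l *~ k] with [l] a local equation of the boundary divisor and [n] orthogonal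
    to the ray. Then [n] is a unit near the mark, and [l] vanishes there to the order given by the
    tangency. *)
Lemma char_val_end_mark m j : unit_at end_mark (mark C (inr j)) (- pairing c m j)
  (fun q => char_val m q *
     bracket (hrep (mark C (inr j))) (hrep q) ^ (- pairing c m j)).
Proof.
set p := mark C (inr j); set r := tc_ray c j.
have Dp : (\sum_(j' | (tc_ray c j' == r) && (mark C (inr j') == p)) tc_mult c j'
    = tc_mult c j)%N.
  rewrite (bigD1 j) ?eqxx //= big1 ?addn0 // => j' /andP[/andP[_ /eqP]].
  by move=> /(@mark_inj _ _ _ _ _ _ _ _ C)[->]; rewrite eqxx.
have [ordz ord0] := amap_tangency C r p.
(* The point lies in the chart of [r]: elsewhere the divisor has multiplicity 0, whereas
   [tc_mult c j] is positive. *)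
have [[z cz]|nz] := pselect (exists z, chart_coords (Some r) (amap C p) z);
    last first.
  by have := tc_mult_gt0 c j; rewrite -Dp (ord0 nz).
have [U [g [l [oU Up cg lr [W [d [P [Q [oW Wp Pp]]]]]]]]] := ordz z cz.
rewrite Dp => PQ.
pose k : int := Num.floor (m (ray_gen r) : R).
pose n := m - l *~ k.
have nr : n (ray_gen r) = 0 :> R.
  by rewrite charDE charNE charMzE lr floor_ray subrr.
have Sn : dual_monoid (Some r) n by apply/dual_monoidSome; rewrite nr.
have SNn : dual_monoid (Some r) (- n).
  by apply/dual_monoidSome; rewrite charNE nr oppr0.
have Sl : dual_monoid (Some r) l by apply/dual_monoidSome; rewrite lr ler01.
have unit_n : unit_at end_mark p 0 (char_val n).
  have [U' [g' [oU' Up' cg' reg]]] := amap_morphism cz.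
  apply: (regular_unit_at oU' Up' (reg n Sn)).
    (* The coordinates of [n] and [- n] multiply to 1, so that of [n] is nonzero at [p]. *)
    have [[g0 gD] _] := cg' p Up'.
    have := gD n (- n) Sn SNn; rewrite subrr g0 => /esym/eqP.
    by apply: contraTneq => ->; rewrite mul0r eq_sym oner_eq0.
  move=> q Eq Uq; apply: char_val_chart Eq (cg' q Uq) Sn.
pose w := tc_mult c j.
have unit_l : unit_at end_mark p (- w%:Z)
    (fun q => char_val l q * (bracket (hrep p) (hrep q) ^+ w)^-1).
  have [dX [X [Xp XW]]] := oW p Wp; have [dY [Y [Yp YU]]] := oU p Up.
  have [Qp _] := PQ p Wp.
  apply: (@unit_at_quotient _ _ _ _ _ (dX + dY) d (w + d)
    (fun q => bform dX X q * bform dY Y q) (bform d P) (bform (w + d) Q));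
    rewrite ?mulf_neq0 //; try by eexists.
  - by apply: is_form_mul; eexists.
  - by rewrite PoszD addrAC subrr add0r.
  move=> q Eq; rewrite mulf_eq0 negb_or => /andP[Xq Yq] Qq.
  have qp : p != q by apply/eqP => qp; apply: Eq; exists j.
  rewrite (char_val_chart Eq (cg q (YU q Yq)) Sl) (PQ q (XW q Xq)).2.
  by field; rewrite Qq expf_neq0 // bracket_neq0.
have := unit_atM unit_n (unit_atX k unit_l).
have -> : 0 + - w%:Z * k = - pairing c m j by rewrite add0r mulNr mulrC.
apply: unit_at_eq => q Eq.
have qp : p != q by apply/eqP => qp; apply: Eq; exists j.
have b0 := bracket_neq0 qp.
rewrite expfzMl mulrA -char_valMz // -char_valD // subrK; congr (_ * _).
by rewrite exprnP invr_expz exprz_exp /pairing mulrC mulrN.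
Qed.

(* The character [m] pulled back to the curve has divisor
   [sum_j <m, Delta_j> p_j], so that dividing it by the corresponding product of
   linear forms leaves a constant. *)
Lemma char_val_const (i : I) m : exists a, forall q, ~ end_mark q ->
  char_val m q *
    \prod_j bracket (hrep (mark C (inr j))) (hrep q) ^ (- pairing c m j) = a.
Proof.
pose b j q := bracket (hrep (mark C (inr j))) (hrep q).
(* The product of the linear forms of the end marks is the nonzero form whose zeros absorb the junk
   values. *)
have fb (s : seq J) : is_form (size s) (fun q => \prod_(j <- s) b j q).
  elim: s => [|j s IH].
    have [P PE] := @is_form_const K 1.
    by exists P => q; rewrite -PE big_nil.
  have [P PE] := is_form_mul (is_form_bracket (mark C (inr j))) IH.
  by exists P => q; rewrite -PE big_cons.
have bX p j : p <> mark C (inr j) ->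
    unit_at end_mark p (- pairing c m j) (fun q => b j q ^ (- pairing c m j)).
  move=> pj; rewrite -[X in unit_at _ _ X _]mul1r.
  by apply/unit_atX/unit_at_bracket/eqP => jp; apply: pj.
apply: (unit_everywhere_const (fb (index_enum J))).
- exists (mark C (inl i)); rewrite prodf_seq_neq0; apply/allP => j _ /=.
  by apply: bracket_neq0; rewrite (inj_eq (@mark_inj _ _ _ _ _ _ _ _ C)).
- move=> p [j pj]; apply/eqP; rewrite prodf_seq_eq0; apply/hasP; exists j.
    exact: mem_index_enum.
  by rewrite /b pj /= /bracket mulrC subrr.
move=> p; have [[j pj]|Ep] := pselect (end_mark p).
  (* At the end mark [j] its own factor is grouped with the character, as in [char_val_end_mark];
     the other factors are units there, and the total degree is 0. *)
  have <- : - pairing c m j + \sum_(j' | j' != j) - pairing c m j' = 0.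
    rewrite sumrN -opprD; have := pairing_sum c m.
    by rewrite (bigD1 j) //= => ->; rewrite oppr0.
  have Ej' j' : j' != j -> p <> mark C (inr j').
    by rewrite pj => jj' /(@mark_inj _ _ _ _ _ _ _ _ C)[/esym/eqP]; apply/negP.
  have := unit_at_prod (index_enum J) (fun j' jj' => bX p j' (Ej' j' jj')).
  have := char_val_end_mark m j; rewrite -pj => Hj /(unit_atM Hj).
  by apply: unit_at_eq => q _; rewrite [in RHS](bigD1 j) //= mulrA pj.
have <- : 0 + \sum_j - pairing c m j = 0.
  by rewrite sumrN pairing_sum oppr0 addr0.
apply: unit_atM; first exact: char_val_unit_at.
by apply: unit_at_prod => j _; apply: bX => pj; apply: Ep; exists j.
Qed.

(** Compare the constant of [char_val_const] at the marks [i] and [i0], neither of which is an end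
    mark. *)
Lemma ev_ratio (i0 i : I) m : ev C i m = ev C i0 m *
  \prod_j (bracket (hrep (mark C (inr j))) (hrep (mark C (inl i))) /
           bracket (hrep (mark C (inr j))) (hrep (mark C (inl i0)))) ^ pairing c m j.
Proof.
have Ei k : ~ end_mark (mark C (inl k)).
  by move=> [j /(@mark_inj _ _ _ _ _ _ _ _ C)].
have b0 k j : bracket (hrep (mark C (inr j))) (hrep (mark C (inl k))) != 0.
  by apply: bracket_neq0; rewrite (inj_eq (@mark_inj _ _ _ _ _ _ _ _ C)).
have [a aE] := char_val_const i0 m.
have := aE _ (Ei i); rewrite -(aE _ (Ei i0)) !(char_valE m (evE C _)).
under eq_bigr => j _ do rewrite -invr_expz.
under [in RHS]eq_bigr => j _ do rewrite -invr_expz.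
rewrite !prodfV => H.
under eq_bigr => j _ do rewrite expfzMl exprz_inv -invr_expz.
rewrite big_split /= prodfV [X in _ = _ * X]mulrC mulrA -H mulfVK //.
by apply/prodf_neq0 => j _; rewrite expfz_neq0.
Qed.

End CurveCharacters.

Lemma expfz_sum (F : fieldType) (T : Type) (s : seq T) (P : pred T) (x : F)
    (e : T -> int) : x != 0 ->
  \prod_(t <- s | P t) x ^ e t = x ^ (\sum_(t <- s | P t) e t).
Proof.
by move=> x0; elim/big_rec2: _ => [|t y z _ ->]; rewrite ?expr0z ?expfzDr.
Qed.

Lemma torus_ptP (K : fieldType) (R : realType) (V : vectType R) (N : set V)
  (s t : torus_pt K N) : s =1 t -> s = t.
Proof.
case: s t => [s s0 sD] [t t0 tD] /= /funext st; subst t.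
by congr TorusPt; exact: Prop_irrelevance.
Qed.

(** * Extension of the evaluations to the ambient torus *)

Section EvaluationExtension.
Variables (K : closedFieldType) (R : realType) (V : vectType R) (N : set V).
Variables (S : ray_fan N) (I J : finType) (c : tangency S J) (i0 i : I).
Local Notation L := (I + J)%type.
Implicit Types (x y : gm K L) (m : charlat N).

Definition end_mark_pair (j : J) (k : I) : dpairs L :=
  exist (fun d : L * L => d.1 != d.2) (inr j, inl k) isT.

Definition pl_ratio x m : K :=
  \prod_j (val x (end_mark_pair j i) / val x (end_mark_pair j i0)) ^ pairing c m j.

Lemma gm_neq0 x d : val x d != 0.
Proof. exact: (forallP (valP x)). Qed.

Lemma pl_ratio0 x : pl_ratio x 0 = 1.
Proof. by apply: big1 => j _; rewrite pairing0 expr0z. Qed.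

Lemma pl_ratioD x m n : pl_ratio x (m + n) = pl_ratio x m * pl_ratio x n.
Proof.
rewrite /pl_ratio -big_split /=; apply: eq_bigr => j _.
by rewrite pairingD expfzDr // mulf_neq0 ?invr_eq0 ?gm_neq0.
Qed.

Lemma pl_ratioM x y m : pl_ratio (gm_mul x y) m = pl_ratio x m * pl_ratio y m.
Proof.
rewrite /pl_ratio -big_split /=; apply: eq_bigr => j _.
by rewrite -expfzMl !ffunE invfM mulrACA.
Qed.

(** The factor [t (inr j)] cancels in each ratio, and [t (inl i) / t (inl i0)] receives the total
    exponent 0 by [pairing_sum]. *)
Lemma pl_ratio_orbit x y m : same_orbit x y -> pl_ratio x m = pl_ratio y m.
Proof.
move=> [t t0 xy].
have tt0 : t (inl i) / t (inl i0) != 0 by rewrite mulf_neq0 ?invr_eq0 ?t0.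
transitivity (\prod_j (t (inl i) / t (inl i0)) ^ pairing c m j * pl_ratio x m).
  by rewrite expfz_sum // pairing_sum expr0z mul1r.
rewrite /pl_ratio -big_split /=; apply: eq_bigr => j _; rewrite -expfzMl !xy /=.
by congr (_ ^ _); field; rewrite !gm_neq0 !t0.
Qed.

Lemma pl_ratio_repr x m : pl_ratio (repr (\pi_(pl_torus K L) x)) m = pl_ratio x m.
Proof.
apply: pl_ratio_orbit.
have : \pi_(pl_torus K L) (repr (\pi_(pl_torus K L) x)) = \pi_(pl_torus K L) x.
  by rewrite reprK.
by move/eqmodP/asboolP.
Qed.

Definition ev_ext (x : pl_torus K L * torus_pt K N) : torus_pt K N :=
  torus_mul x.2
    (TorusPt (pl_ratio0 (repr x.1)) (fun m n => pl_ratioD (repr x.1) m n)).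

Lemma ev_extE x t m : ev_ext (\pi_(pl_torus K L) x, t) m = t m * pl_ratio x m.
Proof. by rewrite /= pl_ratio_repr. Qed.

Lemma ev_ext_morphism : is_torus_morphism ev_ext.
Proof.
split=> [x y s t|m].
  apply: torus_ptP => m.
  transitivity (ev_ext (\pi_(pl_torus K L) x, s) m *
                ev_ext (\pi_(pl_torus K L) y, t) m); last by [].
  by rewrite !ev_extE pl_ratioM mulrACA.
(* [pl_ratio] is a single Laurent monomial; [e] collects the exponent of each coordinate. For
   [i = i0] the two indicators cancel. *)
pose e (d : dpairs L) : int :=
  \sum_j pairing c m j * ((d == end_mark_pair j i)%:R - (d == end_mark_pair j i0)%:R).
exists 1%N, (fun=> 1), (fun=> e), (fun=> m) => x t.
rewrite big_ord1 mul1r ev_extE mulrC; congr (_ * _).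
under [RHS]eq_bigr => d _ do rewrite -expfz_sum ?gm_neq0 //.
rewrite exchange_big /=; apply: eq_bigr => j _.
have single d' : \prod_(d : dpairs L) val x d ^ ((d == d')%:R : int) = val x d'.
  rewrite (bigD1 d') //= eqxx expr1z big1 ?mulr1 // => d /negPf ->.
  by rewrite expr0z.
under eq_bigr => d _ do rewrite mulrC -exprz_exp expfzDr ?gm_neq0 // -invr_expz.
set p := pairing c m j.
rewrite -(single (end_mark_pair j i)) -(single (end_mark_pair j i0)).
rewrite -prodfV -big_split /=.
by elim/big_rec2: _ => [|d y z _ <-]; rewrite ?exp1rz // expfzMl.
Qed.

Lemma ev_ext_embed (C : alg_curve K I c) : ev_ext (embed i0 C) = ev C i.
Proof.
apply: torus_ptP => m; rewrite ev_extE (ev_ratio C i0 i); congr (_ * _).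
by apply: eq_bigr => j _; rewrite !ffunE.
Qed.

End EvaluationExtension.

(** * Distances and harmonic functions on metric trees *)

Section SimplePaths.
Variables (T : eqType) (e : rel T).
Hypothesis e_sym : symmetric e.
Hypothesis e_acyclic : forall s, ucycle e s -> (size s <= 2)%N.

(** Skip the common beginning, follow [p] to its first vertex [z] on [q], and return along [q]. This
    is a simple cycle, of length at least 3 because the first steps differ. *)
Lemma simple_path_unique v p q : path e v p -> path e v q ->
  uniq (v :: p) -> uniq (v :: q) -> last v p = last v q -> p = q.
Proof.
elim: p v q => [|a p IH] v [|b q] //=.
- by move=> _ _ _ /andP[vq _] vE; rewrite {1}vE mem_last in vq.
- by move=> _ _ /andP[vp _] _ vE; rewrite -{1}vE mem_last in vp.
move=> /andP[va ap] /andP[vb bq] /andP[vp up] /andP[vq uq] pq.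
have [ab|ab] := eqVneq a b.
  by subst b; congr (_ :: _); apply: (IH a).
have pE : has (mem (b :: q)) (a :: p).
  by apply/hasP; exists (last a p); rewrite ?mem_last //= pq mem_last.
have vp' : path e v (a :: p) by rewrite /= va.
have vq' : path e v (b :: q) by rewrite /= vb.
have {}ab : head v (a :: p) != head v (b :: q) by [].
rewrite -/(uniq (a :: p)) in up; rewrite -/(uniq (b :: q)) in uq.
move: {va vb ap bq pq}(a :: p) (b :: q) vp up vq uq ab vq' vp' pE => {a b IH}p {}q.
move=> vp up vq uq ab vq' vp' pE.
case/split_find: pE vp up vp' ab => z p1 p2 /= zq p1q vp up vp' ab.
case/path.splitP: zq vq uq vq' ab p1q => q1 q2 vq uq vq' ab p1q.
have /e_acyclic : ucycle e (v :: rcons p1 z ++ rev q1).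
  apply/andP; split.
    rewrite /= rcons_cat cat_path last_rcons.
    move: vp'; rewrite cat_path => /andP[-> _] /=.
    move: vq'; rewrite cat_path => /andP[vq' _].
    have := rev_path e v (rcons q1 z).
    rewrite last_rcons belast_rcons rev_cons => ->.
    by rewrite (eq_path (e' := e)) // => x y; rewrite e_sym.
  rewrite /= mem_cat negb_or mem_rev; apply/andP; split.
    apply/andP; split; first by apply: contra vp; rewrite mem_cat => ->.
    by apply: contra vq; rewrite mem_cat mem_rcons inE => ->; rewrite !orbT.
  move: up uq; rewrite !cat_uniq rev_uniq !rcons_uniq.
  move=> /andP[-> _] /andP[/andP[zq1 ->] _]; rewrite andbT /=.
  apply/hasPn => x; rewrite mem_rev => xq1; rewrite mem_rcons inE negb_or.
  apply/andP; split; first by apply: contraNneq zq1 => <-.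
  apply: contra p1q => xp1; apply/hasP; exists x => //=.
  by rewrite mem_cat mem_rcons inE xq1 orbT.
move: ab; rewrite /= size_cat size_rcons size_rev addSn.
case: p1 {vp up vp' p1q} => [|? ?] //=; case: q1 {vq uq vq'} => [|? ?] //=.
by rewrite eqxx.
Qed.

End SimplePaths.

Section Geodesics.
Variables (R : realType) (C : metric_tree R).
Implicit Types (v w x : C) (p : seq C).

Lemma geodesicP v w : [/\ path (@tadj R C) v (geodesic v w),
  uniq (v :: geodesic v w) & last v (geodesic v w) = w].
Proof.
pose P := [set p | [/\ path (@tadj R C) v p, uniq (v :: p) & last v p = w]]%classic.
suff [p Pp] : exists p, P p by exact: (@xgetPex _ [::] P (ex_intro _ p Pp)).
have /connectP[p vp wE] := tadj_connected v w.
by case/shortenP: vp wE => p' vp' up' _ wE; exists p'.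
Qed.

Lemma geodesicE v p : path (@tadj R C) v p -> uniq (v :: p) ->
  geodesic v (last v p) = p.
Proof.
move=> vp up; have [vg ug lg] := geodesicP v (last v p).
exact: (simple_path_unique (@tadj_sym _ C) (@tadj_acyclic _ C) vg vp ug up).
Qed.

Lemma walk_length_cons v w p :
  walk_length v (w :: p) = fine (tlen v w) + walk_length w p.
Proof. by rewrite /walk_length /= big_cons. Qed.

Lemma walk_length_cat v p q :
  walk_length v (p ++ q) = walk_length v p + walk_length (last v p) q.
Proof.
elim: p v => [|w p IH] v /=; first by rewrite /walk_length [X in X + _]big_nil add0r.
by rewrite !walk_length_cons IH addrA.
Qed.

Lemma tdist_path v p : path (@tadj R C) v p -> uniq (v :: p) ->
  tdist v (last v p) = walk_length v p.
Proof. by move=> vp up; rewrite /tdist geodesicE. Qed.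

Lemma tdist_away x v w : tadj v w -> w \notin x :: geodesic x v ->
  tdist x w = tdist x v + fine (tlen v w).
Proof.
move=> vw wg; have [xg ug lg] := geodesicP x v.
have := @tdist_path x (rcons (geodesic x v) w).
rewrite rcons_path lg vw xg -rcons_cons rcons_uniq wg ug last_rcons => -> //.
by rewrite -cats1 walk_length_cat lg walk_length_cons {2}/walk_length big_nil addr0.
Qed.

(** The geodesic cut at [w] is the geodesic to [w] and avoids [v], so [tdist_away] applies with the
    two vertices exchanged. *)
Lemma tdist_back x v w : tadj v w -> w \in x :: geodesic x v ->
  tdist x v = tdist x w + fine (tlen w v).
Proof.
move=> vw wg; have [xg ug lg] := geodesicP x v.
have [wx ux lw] := geodesicP x w.
apply: tdist_away; first by rewrite tadj_sym.
have vw' : v != w by apply: contraTneq vw => ->; rewrite tadj_irr.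
case/splitPl: wg xg ug lg => g1 g2 g1w xg ug lg.
have {lw}-> : geodesic x w = g1.
  rewrite -g1w; apply: geodesicE; first by move: xg; rewrite cat_path => /andP[].
  by move: ug; rewrite -cat_cons cat_uniq => /andP[].
case: g2 xg ug lg => [|a g2] xg ug lg.
  by move: vw'; rewrite -lg cats0 g1w eqxx.
move: ug; rewrite -cat_cons cat_uniq => /and3P[_ /hasPn H _]; apply: H.
by rewrite -lg last_cat /= mem_last.
Qed.

(** [u] is the penultimate vertex. For a neighbour [w] on the geodesic, the part up to [w] followed
    by [v] is a simple path, hence by uniqueness the whole geodesic. *)
Lemma on_geodesic x v : v != x -> exists2 u, tadj v u &
  forall w, tadj v w -> (w \in x :: geodesic x v) = (w == u).
Proof.
move=> vx; have [xg ug lg] := geodesicP x v.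
case/lastP: (geodesic x v) xg ug lg => [|g y] xg ug lg.
  by move: vx; rewrite -lg eqxx.
move: lg xg ug; rewrite last_rcons => ->; rewrite rcons_path => /andP[xg gv] ug.
exists (last x g); first by rewrite tadj_sym.
move=> w vw; apply/idP/eqP => [wg|->]; last first.
  by rewrite -rcons_cons mem_rcons inE mem_last orbT.
have gE : geodesic x v = rcons g v.
  by rewrite -[v in LHS](last_rcons x g) geodesicE // rcons_path xg.
have := wg; rewrite -gE => /(tdist_back vw).
move: wg; rewrite -rcons_cons mem_rcons inE => /orP[/eqP wv|wg].
  by move: vw; rewrite wv tadj_irr.
case/splitPl: wg xg gv ug gE => g1 g2 g1w xg gv ug gE _.
have g1u : path (@tadj R C) x (rcons g1 v) /\ uniq (x :: rcons g1 v).
  rewrite rcons_path g1w tadj_sym vw andbT; split.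
    by move: xg; rewrite cat_path => /andP[].
  move: ug; rewrite -!rcons_cons !rcons_uniq -cat_cons mem_cat negb_or cat_uniq.
  by move=> /andP[/andP[-> _] /andP[-> _]].
have := geodesicE g1u.1 g1u.2; rewrite last_rcons gE => /eqP.
by rewrite eqseq_rcons eqxx andbT => /eqP ->.
Qed.

End Geodesics.

Section InnerVertices.
Variables (R : realType) (C : abs_curve R).
Implicit Types (v w x : C) (p : seq C).

Lemma two_neighbours_inner v x y : tadj v x -> tadj v y -> x != y -> inner v.
Proof.
move=> vx vy xy; rewrite /inner /valence neq_ltn; apply/orP; right.
by apply/card_gt1P; exists x, y; split.
Qed.

(** An intermediate vertex of a simple path has two distinct neighbours, so feet can occur only at
    the ends. *)
Lemma inner_path v p : path (@tadj R C) v p -> uniq (v :: p) ->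
  inner (last v p) -> all (@inner R C) p.
Proof.
elim: p v => //= a p IH v /andP[va ap] /andP[vp up] lp.
rewrite (IH a) // andbT; case: p ap vp lp {IH up} => //= b p /andP[ab _] vp _.
apply: (@two_neighbours_inner a v b) => //; first by rewrite tadj_sym.
by move: vp; rewrite !inE !negb_or => /and3P[].
Qed.

Lemma tlen_inner v w : tadj v w -> inner v -> inner w -> 0 < fine (tlen v w).
Proof.
move=> vw iv iw; have := tlen_gt0 vw; have := abs_legs vw.
case: (tlen v w) => [r _|H|] //=; have [/(_ erefl)] := H.
by case=> /eqP; [rewrite (negPf iv)|rewrite (negPf iw)].
Qed.

(* Along an edge at [v] the distance to [x] decreases exactly towards [x]. *)
Lemma tdist_laplacian x v : inner x -> inner v ->
  \sum_(w | tadj v w && inner w) (tdist x w - tdist x v) / fine (tlen v w) =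
  (#|[pred w | tadj v w && inner w]|)%:R - 2 * (v != x)%:R :> R.
Proof.
move=> ix iv.
have term w : tadj v w -> inner w -> (tdist x w - tdist x v) / fine (tlen v w) =
    1 - 2 * (w \in x :: geodesic x v)%:R.
  move=> vw iw; have l0 := lt0r_neq0 (tlen_inner vw iv iw).
  have [wg|wg] := boolP (w \in x :: geodesic x v).
    by rewrite (tdist_back vw wg) -(tlen_sym vw) /=; field.
  by rewrite (tdist_away vw wg) /=; field.
rewrite (eq_bigr (fun w => 1 - 2 * (w \in x :: geodesic x v)%:R)); last first.
  by move=> w /andP[]; exact: term.
rewrite sumrB sumr_const -mulr_sumr; congr (_ - 2 * _).
have [->|vx] := eqVneq v x.
  have -> : geodesic x x = [::] by apply: (@geodesicE _ _ x [::]).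
  rewrite big1 // => w /andP[xw _]; rewrite inE.
  by case: eqP xw => // ->; rewrite tadj_irr.
(* The one neighbour towards [x] lies on a geodesic ending at an inner vertex, so it is inner and
   does occur in the sum. *)
have [u vu uE] := on_geodesic vx.
have iu : inner u.
  have := uE u vu; rewrite eqxx inE => /orP[/eqP -> //|].
  have [xg ug lg] := geodesicP x v.
  by apply/allP; apply: inner_path xg ug _; rewrite lg.
rewrite (bigD1 u) ?vu //= uE // eqxx big1 ?addr0 // => w /andP[/andP[vw _] /negPf wu].
by rewrite uE // wu.
Qed.

(** At a maximum of [H] all terms of the harmonic sum have the same sign, so each vanishes. The
    maximum spreads along geodesics, which stay among the inner vertices. *)
Lemma inner_harmonic_const (H : C -> R) :
  (forall v, inner v ->
     \sum_(w | tadj v w && inner w) (H w - H v) / fine (tlen v w) = 0) ->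
  forall v w, inner v -> inner w -> H v = H w.
Proof.
move=> harm v w0 iv iw0.
suff [v0 E] : exists v0, forall w, inner w -> H w = H v0.
  by rewrite (E v iv) (E w0 iw0).
case: (@arg_maxP _ _ _ v (@inner R C) H iv) => v0 iv0 max0.
exists v0 => w iw; have [vg ug lg] := geodesicP v0 w.
rewrite -lg in iw *; have := inner_path vg ug iw.
move: (geodesic v0 w) vg {ug lg iw} => p.
suff : forall u, inner u -> H u = H v0 -> path (@tadj R C) u p ->
    all (@inner R C) p -> H (last u p) = H v0.
  by move=> /(_ v0 iv0 erefl).
elim: p => //= a p IH u iu uH /andP[ua ap] /andP[ia ip].
apply: IH => //; apply/eqP; rewrite -uH eq_sym -subr_eq0.
have l0 b : tadj u b && inner b -> 0 < fine (tlen u b).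
  by move=> /andP[ub ib]; apply: tlen_inner.
have := @psumr_eq0P R C (fun b => tadj u b && inner b)
  (fun b => (H u - H b) / fine (tlen u b)).
have pos b : tadj u b && inner b -> 0 <= (H u - H b) / fine (tlen u b).
  move=> ub; rewrite divr_ge0 ?(ltW (l0 _ ub)) // uH subr_ge0.
  by apply: max0; case/andP: ub.
have sum0 : \sum_(b | tadj u b && inner b) (H u - H b) / fine (tlen u b) = 0.
  have := congr1 -%R (harm u iu); rewrite oppr0 -sumrN => E; rewrite -[RHS]E.
  by apply: eq_bigr => b _; rewrite -mulNr opprB.
move=> /(_ pos sum0 a); rewrite ua ia => /(_ isT)/eqP.
by rewrite mulf_eq0 invr_eq0 (gt_eqF (l0 _ _)) ?ua ?ia ?orbF.
Qed.

End InnerVertices.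

(** * Differences of tropical evaluations in terms of distances *)

Section Evaluation.
Variables (R : realType) (V : vectType R) (N : set V) (I J : finType).
Variable Delta : J -> V.
Hypothesis Delta_sum : \sum_j Delta j = 0.
Variable D : trop_curve N I Delta.

(** A foot has a unique neighbour, so a foot next to [v] belongs to a leg rooted at [v]. *)
Lemma sum_feet (v : D) (F : D -> R) : inner v ->
  \sum_(w | tadj v w && ~~ inner w) F w =
  \sum_(l | leg_root D l == v) F (leg_foot D l).
Proof.
move=> iv.
rewrite -(big_imset (h := leg_foot D) (A := [pred l | leg_root D l == v]) F);
  last by move=> ? ? _ _; apply: leg_foot_inj.
apply: eq_bigl => w; apply/andP/imsetP => [[vw]|[l /eqP rl ->]]; last first.
  rewrite -rl leg_adj; split=> //; rewrite negbK; apply/eqP.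
  by apply/leg_foot_im; exists l.
rewrite negbK => /eqP w1; have [l lw] := (leg_foot_im w).1 w1.
exists l => //; rewrite inE; apply/eqP.
move/eqP: w1 => /card1P[u uE].
have /eqP -> : leg_root D l == u.
  by have := uE (leg_root D l); rewrite !inE => <-; rewrite -lw tadj_sym leg_adj.
by apply/esym/eqP; have := uE v; rewrite !inE => <-; rewrite tadj_sym.
Qed.

(** The difference quotients are direction vectors; balancing trades the inner edges at [v] for its
    legs, and the legs of [I] contribute 0. *)
Lemma tpos_laplacian (m : 'Hom(V, R^o)) (v : D) : inner v ->
  \sum_(w | tadj v w && inner w) ((m (tpos w) : R) - m (tpos v)) / fine (tlen v w) =
  - \sum_(j | leg_root D (inr j) == v) (m (Delta j) : R).
Proof.
move=> iv.
rewrite (eq_bigr (fun w => m (tdir v w) : R)); last first.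
  move=> w /andP[vw iw]; rewrite (tpos_affine iv iw vw) linearD linearZ /=.
  have l0 := lt0r_neq0 (tlen_inner vw iv iw).
  by rewrite addrC addKr [_ *: _]mulrC mulfK.
have := congr1 m (tdir_balanced iv); rewrite linear0 linear_sum.
rewrite (bigID (@inner R D)) /= => /eqP; rewrite addr_eq0 => /eqP ->.
rewrite (sum_feet (fun w => m (tdir v w) : R) iv) big_sumType /= big1 ?add0r.
  by congr (- _); apply: eq_bigr => j /eqP <-; rewrite tdir_unmarked.
by move=> i /eqP <-; rewrite tdir_marked linear0.
Qed.

Lemma tev_sub (m : 'Hom(V, R^o)) (i0 i : I) :
  (m (tev D i) : R) - m (tev D i0) =
  \sum_j (m (Delta j) : R) *
    (- tdist (leg_root D (inr j)) (leg_root D (inl i)) / 2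
     - - tdist (leg_root D (inr j)) (leg_root D (inl i0)) / 2).
Proof.
pose H v : R := m (tpos v) +
  2^-1 * \sum_j (m (Delta j) : R) * tdist (leg_root D (inr j)) v.
have mD : \sum_j (m (Delta j) : R) = 0.
  by have := congr1 m Delta_sum; rewrite linear0 linear_sum.
have : H (leg_root D (inl i)) = H (leg_root D (inl i0)).
  apply: inner_harmonic_const; try exact: leg_root_inner.
  move=> v iv.
  transitivity (- \sum_(j | leg_root D (inr j) == v) (m (Delta j) : R) +
    2^-1 * \sum_j (m (Delta j) : R) *
      ((#|[pred w | tadj v w && inner w]|)%:R - 2 * (v != leg_root D (inr j))%:R)).
    rewrite -tpos_laplacian //.
    rewrite [X in _ = _ + _ * X](eq_bigr (fun j =>
      \sum_(w | tadj v w && inner w) (m (Delta j) : R) *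
        ((tdist (leg_root D (inr j)) w - tdist (leg_root D (inr j)) v) /
         fine (tlen v w)))); last first.
      by move=> j _; rewrite -mulr_sumr tdist_laplacian //; exact: leg_root_inner.
    rewrite exchange_big mulr_sumr -big_split /=; apply: eq_bigr => w _.
    rewrite /H; set a := fine _.
    rewrite opprD addrACA -mulrBr -sumrB mulrDl -mulrA mulr_suml.
    by congr (_ + _ * _); apply: eq_bigr => j _; rewrite -mulrBr mulrA.
  (* The number of inner neighbours is the same for all [j] and drops out since the degrees sum to
     0. So does the constant 2 in [2 - 2 * (v == leg_root D (inr j))]; the rest cancels the legs at
     [v] thanks to the factor one half in [H]. *)
  under [X in _ + _ * X]eq_bigr => j _ do rewrite mulrBr.
  rewrite sumrB -mulr_suml mD mul0r sub0r.
  have /eqP : \sum_j (m (Delta j) : R) * (2 * (v != leg_root D (inr j))%:R) +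
      2 * \sum_(j | leg_root D (inr j) == v) (m (Delta j) : R) = 0.
    transitivity (2 * \sum_j (m (Delta j) : R)); last by rewrite mD mulr0.
    rewrite [X in _ + _ * X]big_mkcond !mulr_sumr -big_split /=.
    apply: eq_bigr => j _.
    by rewrite [v == _]eq_sym; case: eqP => _ /=; ring.
  rewrite addr_eq0 => /eqP ->.
  by rewrite opprK mulrA mulVf ?mul1r ?addNr // pnatr_eq0.
rewrite /H -/(tev D i) -/(tev D i0) => E.
pose d i' j := tdist (leg_root D (inr j)) (leg_root D (inl i')).
rewrite [RHS](eq_bigr (fun j => 2^-1 * ((m (Delta j) : R) * d i0 j) -
  2^-1 * ((m (Delta j) : R) * d i j))); last by move=> j _; rewrite /d; field.
rewrite sumrB -!mulr_sumr; apply/eqP; rewrite subr_eq addrAC -subr_eq.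
by rewrite opprK E addrC.
Qed.

End Evaluation.

(** * The tree of balls of an ultrametric *)

(* A finite ultrametric, in the reversed convention in which [U a b] is large
   when [a] and [b] are close, with a point [o] at distance infinity. *)
Record rooted_ultrametric (R : realType) (L : finType) (o : L) := RootedUltrametric {
  um_fun :> L -> L -> R;
  um_sym : forall a b, um_fun a b = um_fun b a;
  um_trans : forall r b a c, r <= um_fun a b -> r <= um_fun b c -> r <= um_fun a c;
  um_self : forall a b, a != o -> b != a -> um_fun a b < um_fun a a;
  um_root : forall b, um_fun o b = um_fun o o;
  um_root_lt : forall a b, a != o -> b != o -> um_fun o o < um_fun a b
}.

(* The tree of balls of a rooted ultrametric: the foot of the leg [a] is the ball
   {a}, except that the foot of the leg [o] is the whole space. *)
Section BallTree.
Variables (R : realType) (L : finType) (o : L) (U : rooted_ultrametric R o).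
Hypothesis card_L : (3 <= #|L|)%N.
Implicit Types (a b x : L).

(** In the reversed convention this is the smallest ball containing both points. *)
Definition ballset a b : {set L} := [set x | U a b <= U a x].
Definition is_ball (B : {set L}) := [exists ab : L * L, B == ballset ab.1 ab.2].
Definition ball := {B : {set L} | is_ball B}.
Implicit Types v w z : ball.
Local Notation "a \in_ v" := (a \in val v) (at level 70).
Local Notation "v <=_ w" := (val v \subset val w) (at level 70).
Local Notation "v <_ w" := (val v \proper val w) (at level 70).

Fact ballset_is_ball a b : is_ball (ballset a b).
Proof. by apply/existsP; exists (a, b). Qed.
Definition mkball a b : ball := exist is_ball _ (ballset_is_ball a b).

(** A ball is a bare set, so that equality of vertices is extensional. The center depends on the
    chosen presentation, the radius does not. *)
Definition ball_rep v : L * L := xchoose (existsP (valP v)).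
Definition center v : L := (ball_rep v).1.
Definition radius v : R := U (center v) (ball_rep v).2.

Lemma ball_repE v : v = mkball (center v) (ball_rep v).2.
Proof. by apply/val_inj/eqP; apply: (xchooseP (existsP (valP v))). Qed.

Lemma um_le_self a b : U a b <= U a a.
Proof. by apply: (um_trans (lexx (U a b))); rewrite [X in _ <= X]um_sym. Qed.

Lemma mem_ball v x : (x \in_ v) = (radius v <= U (center v) x).
Proof. by rewrite {1}(ball_repE v) inE. Qed.

Lemma mem_center v : center v \in_ v.
Proof. by rewrite mem_ball um_le_self. Qed.

Lemma mem_rep2 v : (ball_rep v).2 \in_ v.
Proof. by rewrite mem_ball lexx. Qed.

Lemma mem_ballP v a b : a \in_ v -> (b \in_ v) = (radius v <= U a b).
Proof.
rewrite !mem_ball => va; apply/idP/idP => vb.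
  by rewrite [U (center v) a]um_sym in va; exact: um_trans va vb.
exact: um_trans va vb.
Qed.

Lemma mem_mkball a b : a \in_ mkball a b /\ b \in_ mkball a b.
Proof. by rewrite !inE um_le_self lexx. Qed.

Lemma radius_le v a b : a \in_ v -> b \in_ v -> radius v <= U a b.
Proof. by move=> va vb; rewrite -(mem_ballP _ va). Qed.

Lemma radius_mkball a b : radius (mkball a b) = U a b.
Proof.
have [ma mb] := mem_mkball a b; apply/eqP; rewrite eq_le radius_le //=.
have := mem_center (mkball a b); have := mem_rep2 (mkball a b).
rewrite !inE => ra; rewrite [leRHS]um_sym => ca; exact: um_trans ca ra.
Qed.

Lemma ball_nested v w a : a \in_ v -> a \in_ w -> (v <=_ w) = (radius w <= radius v).
Proof.
move=> va wa; apply/idP/idP => [/fintype.subsetP vw|wv]; last first.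
  apply/fintype.subsetP => x.
  by rewrite (mem_ballP _ va) (mem_ballP _ wa); apply: le_trans.
by apply: radius_le; apply: vw; [exact: mem_center|exact: mem_rep2].
Qed.

Lemma ball_subP v w : v <=_ w -> radius w <= radius v.
Proof.
move=> vw; rewrite -(ball_nested (mem_center v)) //.
exact: (fintype.subsetP vw) _ (mem_center v).
Qed.

Lemma ball_properP v w a : a \in_ v -> a \in_ w -> (v <_ w) = (radius w < radius v).
Proof.
move=> va wa; rewrite properE (ball_nested va wa) (ball_nested wa va) -ltNge.
by case: ltgtP.
Qed.

Lemma ball_proper_radius v w : v <_ w -> radius w < radius v.
Proof.
move=> vw; rewrite -(ball_properP (mem_center v)) //.
exact: (fintype.subsetP (proper_sub vw)) _ (mem_center v).
Qed.

Lemma ball_total v w a : a \in_ v -> a \in_ w -> ~~ (v <=_ w) -> w <_ v.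
Proof. by move=> va wa; rewrite (ball_nested va wa) (ball_properP wa va) -ltNge. Qed.

Definition foot a : ball := mkball a a.

Lemma foot_root x : x \in_ foot o.
Proof. by rewrite inE um_root. Qed.

Lemma foot_set1 a : a != o -> val (foot a) = [set a].
Proof.
move=> ao; apply/setP => x; rewrite !inE; have [->|xa] := eqVneq x a.
  by rewrite lexx.
by rewrite leNgt um_self.
Qed.

Lemma foot_sub v a : a \in_ v -> foot a <=_ v.
Proof.
move=> va; rewrite (ball_nested (mem_mkball a a).1 va) radius_mkball.
exact: radius_le.
Qed.

(** All points are equally far from [o], so a ball containing [o] contains everything. *)
Lemma root_notin v : (o \in_ v) = (v == foot o).
Proof.
apply/idP/eqP => [ov|->]; last exact: foot_root.
apply/val_inj/setP => x; rewrite foot_root (mem_ballP _ ov) um_root.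
exact: radius_le.
Qed.

Definition is_foot v := [exists a, v == foot a].

Lemma foot_inj : injective foot.
Proof.
have setT_n1 a b : a = o -> b != o -> foot a <> foot b.
  move=> -> bo /(congr1 (fun v => val v)); rewrite (foot_set1 bo).
  move=> /(congr1 (fun B : {set L} => #|B|)).
  rewrite cards1; have -> : val (foot o) = [set: L].
    by apply/setP => x; rewrite foot_root inE.
  by rewrite cardsT => L1; move: card_L; rewrite L1.
move=> a b; have [ao|ao] := eqVneq a o; have [bo|bo] := eqVneq b o.
- by rewrite ao bo.
- by move/setT_n1 => /(_ ao bo).
- by move/esym/setT_n1 => /(_ bo ao).
move/(congr1 (fun v => val v)); rewrite !foot_set1 // => /setP/(_ a).
by rewrite !inE eqxx => /esym/eqP.
Qed.

(** The parent relation. It asks for the least larger ball, not merely a minimal one, which the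
    nesting of balls makes available. *)
Definition covers v w := (v <_ w) && [forall z : ball, (v <_ z) ==> (w <=_ z)].

Lemma covers_proper v w : covers v w -> v <_ w.
Proof. by case/andP. Qed.

Lemma covers_min v w z : covers v w -> v <_ z -> w <=_ z.
Proof. by move=> /andP[_ /forallP/(_ z)/implyP]. Qed.

Lemma parent_ex v : v != foot o -> exists w, covers v w.
Proof.
move=> vo; have vT : v <_ foot o.
  rewrite properE; apply/andP; split; first by apply/fintype.subsetP => x; rewrite foot_root.
  by apply: contra vo => /fintype.subsetP/(_ o (foot_root o)); rewrite root_notin.
case: (arg_minnP (P := fun z => v <_ z) (fun z => #|val z|) vT) => w vw minw.
exists w; rewrite /covers vw; apply/forallP => z; apply/implyP => vz.
have wa := fintype.subsetP (proper_sub vw) _ (mem_center v).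
have za := fintype.subsetP (proper_sub vz) _ (mem_center v).
apply: contraT => /(ball_total wa za)/proper_card.
by rewrite ltnNge minw.
Qed.

Lemma parent_unique v w w' : covers v w -> covers v w' -> w = w'.
Proof.
move=> vw vw'; apply: val_inj; apply/eqP; rewrite finset.eqEsubset.
by rewrite (covers_min vw (covers_proper vw')) (covers_min vw' (covers_proper vw)).
Qed.

Lemma child_ex w a : a \in_ w -> w != foot a -> exists2 v, covers v w & a \in_ v.
Proof.
move=> wa wf; have fw : (a \in_ foot a) && (foot a <_ w).
  rewrite (mem_mkball a a).1 finset.properEneq foot_sub // andbT.
  by apply: contraNneq wf => fw; apply/eqP/val_inj.
case: (arg_maxnP (P := fun z => (a \in_ z) && (z <_ w)) (fun z => #|val z|) fw).
move=> v /andP[va vw] maxv; exists v => //; rewrite /covers vw.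
apply/forallP => z; apply/implyP => vz.
have za := fintype.subsetP (proper_sub vz) _ va.
apply: contraT => /(ball_total wa za) zw.
have := maxv z; rewrite za zw => /(_ isT).
by move=> /(leq_trans (proper_card vz)); rewrite ltnn.
Qed.

Lemma child_unique w v v' a : covers v w -> covers v' w -> a \in_ v -> a \in_ v' ->
  v = v'.
Proof.
move=> vw vw' va va'.
have sub u u' : covers u w -> covers u' w -> a \in_ u -> a \in_ u' -> u <=_ u'.
  move=> uw uw' ua ua'; apply: contraT => /(ball_total ua ua')/(covers_min uw').
  by move=> wu; have := covers_proper uw; rewrite properE wu andbF.
by apply: val_inj; apply/eqP; rewrite finset.eqEsubset !sub.
Qed.

End BallTree.

Section BallTreeMetric.
Variables (R : realType) (L : finType) (o : L) (U : rooted_ultrametric R o).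
Hypothesis card_L : (3 <= #|L|)%N.
Implicit Types (a b x : L).
Implicit Types v w z : ball U.
Local Notation foot := (foot U).
Local Notation "a \in_ v" := (a \in val v) (at level 70).
Local Notation "v <=_ w" := (val v \subset val w) (at level 70).
Local Notation "v <_ w" := (val v \proper val w) (at level 70).

Definition ball_adj v w := covers v w || covers w v.

Lemma ball_adj_sym : symmetric ball_adj.
Proof. by move=> v w; rewrite /ball_adj orbC. Qed.

Lemma covers_irr v : covers v v = false.
Proof. by rewrite /covers properE subxx andbF. Qed.

Lemma covers_asym v w : covers v w -> covers w v = false.
Proof.
move=> /covers_proper vw; apply: contraTF vw => /covers_proper.
by rewrite !properE => /andP[-> _]; rewrite andbF.
Qed.

Lemma ball_adj_irr : irreflexive ball_adj.
Proof. by move=> v; rewrite /ball_adj covers_irr. Qed.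

Lemma ball_adj_connected v w : connect ball_adj v w.
Proof.
suff up z : connect ball_adj z (foot o).
  apply: connect_trans (up v) _.
  by rewrite (sym_connect_sym ball_adj_sym).
have [n] := ubnP (#|L| - #|val z|)%N; elim: n z => // n IH z zn.
have [->|zo] := eqVneq z (foot o); first exact: connect0.
have [w' zw] := parent_ex zo.
have /connect1/connect_trans : ball_adj z w' by rewrite /ball_adj zw.
apply.
apply: IH; move: zn.
have := proper_card (covers_proper zw); have : (#|val w'| <= #|L|)%N := max_card _.
move: #|val z| #|val w'| #|L| => i j k; lia.
Qed.

(** Both neighbours of a smallest ball on the cycle would be parents of it, and a parent is
    unique. *)
Lemma ball_adj_acyclic (s : seq (ball U)) : ucycle ball_adj s -> (size s <= 2)%N.
Proof.
case: s => // v0 s; have : v0 \in v0 :: s by rewrite mem_head.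
move: (v0 :: s) => {}s v0s /andP[cs us]; rewrite leqNgt; apply/negP => s3.
case: (arg_minnP (P := fun z => z \in s) (fun z => #|val z|) v0s) => v vs minv.
case: (rot_to vs) => i s' sE.
have : cycle ball_adj (v :: s') by rewrite -sE rot_cycle.
have : uniq (v :: s') by rewrite -sE rot_uniq.
have sub z : z \in v :: s' -> z \in s by rewrite -sE mem_rot.
have : (2 < size (v :: s'))%N by rewrite -sE size_rot.
case: s' sE sub => [|a [|b s']] //= sE sub _.
move=> /and3P[_ ab _]; rewrite rcons_path => /and4P[va _ _ vb].
have up z : z \in v :: [:: a, b & s'] -> ball_adj v z -> covers v z.
  move=> zs /orP[//|/covers_proper/proper_card].
  by rewrite ltnNge minv // sub.
have ca : covers v a by apply: up => //; rewrite !inE eqxx orbT.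
have cb : covers v (last b s').
  apply: up; last by rewrite ball_adj_sym.
  by rewrite inE [X in _ || X]inE mem_last !orbT.
by move: ab; rewrite (parent_unique ca cb) mem_last.
Qed.

Lemma two_points : exists a b, [/\ a != o, b != o & a != b].
Proof.
have : (1 < #|[set~ o]|)%N by rewrite cardsC1; move: card_L; case: #|L|.
by move=> /card_gt1P[a [b []]]; rewrite !inE => ao bo ab; exists a, b.
Qed.

Lemma in_foot_root v x : v != foot o -> x \in_ v -> x != o.
Proof.
by rewrite -root_notin => vo xv; apply: contra vo => /eqP xo; rewrite -[o in o \in _]xo.
Qed.

(** A ball around a point other than [o], reaching to the farthest point other than [o]. It becomes
    the inner vertex at the leg [o]. *)
Lemma body_ex : exists2 v, val v = [set~ o] & covers v (foot o).
Proof.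
have [a [b0 [ao b0o _]]] := two_points.
case: (@arg_minP _ _ _ b0 (fun b => b != o) (U a) b0o) => b bo minb.
have vE : val (mkball U a b) = [set~ o].
  apply/setP => x; rewrite !inE; have [->|xo] := eqVneq x o.
    by rewrite leNgt um_sym um_root um_root_lt.
  exact: minb.
exists (mkball U a b) => //; rewrite /covers; apply/andP; split.
  rewrite properE vE; apply/andP; split.
    by apply/fintype.subsetP => x; rewrite foot_root.
  by apply/negP => /fintype.subsetP/(_ o (foot_root U o)); rewrite !inE eqxx.
apply/forallP => z; apply/implyP => bz.
suff -> : z = foot o by [].
apply/eqP; rewrite -root_notin; apply: contraTT bz => oz.
rewrite properE negb_and negbK; apply/orP; right; rewrite vE.
apply/fintype.subsetP => x xz; rewrite !inE.
by apply: contraNneq oz => xo; move: xz; rewrite xo.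
Qed.

(** A singleton is adjacent only to its parent, the whole space only to the complement of [o]. As at
    least two points differ from [o], that complement is no singleton and separates the singletons
    from the whole space, so no two feet are adjacent. *)
Lemma foot_nbr a : exists2 w, ~~ is_foot w &
  (if a == o then val w = [set~ o] /\ covers w (foot o) else covers (foot a) w) /\
  ball_adj (foot a) =1 pred1 w.
Proof.
have [body bodyE body_o] := body_ex.
have [c [d [c_o d_o cd]]] := two_points.
have body_nf : ~~ is_foot body.
  apply/existsP => -[e /eqP eE]; have [eo|eo] := eqVneq e o.
    by have := foot_root U o; rewrite eo in eE; rewrite -eE bodyE !inE eqxx.
  move: bodyE; rewrite eE foot_set1 // => /setP E.
  have := E c; have := E d; rewrite !inE c_o d_o => /eqP dE /eqP cE.
  by rewrite cE dE eqxx in cd.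
have [->|ao] := eqVneq a o.
  exists body => //; split=> // w /=.
  apply/orP/eqP => [[/covers_proper|wo]|->]; last by right.
    rewrite properE => /andP[_ /negP]; case.
    by apply/fintype.subsetP => x _; rewrite foot_root.
  have wbody : val w \subset val body.
    rewrite bodyE; apply/fintype.subsetP => x xw; rewrite !inE.
    apply: in_foot_root xw; apply: contraTneq wo => ->.
    by rewrite covers_irr.
  apply/val_inj/eqP; rewrite finset.eqEsubset wbody /=; apply: contraT => bw.
  have : val w \proper val body by rewrite properE wbody.
  move=> /(covers_min wo)/fintype.subsetP/(_ o (foot_root U o)).
  by rewrite bodyE !inE eqxx.
have fao : foot a != foot o by rewrite (inj_eq (foot_inj card_L)).
have [w aw] := parent_ex fao; exists w; last first.
  split=> // z /=; apply/orP/eqP => [[az|/covers_proper]|->]; last by left.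
    exact: parent_unique az aw.
  rewrite foot_set1 // => /proper_card; rewrite cards1 ltnS leqn0 cards_eq0.
  by move=> /eqP z0; have := mem_center z; rewrite z0 inE.
apply/existsP => -[b /eqP wb].
have [bo|bo] := eqVneq b o.
  have : val (foot a) \proper val body.
    rewrite foot_set1 // properE finset.sub1set bodyE !inE ao /=.
    apply/negP => /fintype.subsetP E; have := E c; have := E d; rewrite !inE c_o d_o.
    move=> /(_ isT)/eqP dE /(_ isT)/eqP cE; by rewrite cE dE eqxx in cd.
  move=> /(covers_min aw); rewrite wb bo => /fintype.subsetP/(_ o (foot_root U o)).
  by rewrite bodyE !inE eqxx.
have := proper_card (covers_proper aw).
by rewrite wb !foot_set1 // !cards1.
Qed.

Lemma not_foot_neq v a : ~~ is_foot v -> v != foot a.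
Proof. by apply: contra => va; apply/existsP; exists a. Qed.

(** There are a parent and two children: a child containing both points of the presentation of [v]
    would have radius at most that of [v], hence contain [v]. *)
Lemma not_foot_valence v : ~~ is_foot v -> (2 < #|[pred w | ball_adj v w]|)%N.
Proof.
move=> vf; have nf a := not_foot_neq a vf.
have [w vw] := parent_ex (nf o).
have [c1 c1v c1m] := child_ex (mem_center v) (nf _).
have [c2 c2v c2m] := child_ex (mem_rep2 v) (nf _).
apply/card_gt2P; exists w, c1, c2; split.
  by rewrite !inE /ball_adj vw c1v c2v !orbT.
split.
- by apply: contraTneq vw => ->; rewrite (covers_asym c1v).
- apply: contraTneq c1v => c12; rewrite /covers properE negb_and negb_and negbK.
  apply/orP; left; apply/orP; right.
  rewrite (ball_nested (mem_center v) c1m) c12.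
  by rewrite radius_le // -c12.
by apply: contraTneq vw => <-; rewrite (covers_asym c2v).
Qed.

Lemma valence_foot v : (#|[pred w | ball_adj v w]| == 1%N) = is_foot v.
Proof.
apply/idP/idP => [|/existsP[a /eqP ->]].
  by apply: contraTT => /not_foot_valence; case: #|_| => [|[|]].
by have [w _ [_ E]] := foot_nbr a; apply/card1P; exists w => z; rewrite !inE E.
Qed.

(** The scale suits the embedding: a path between two legs climbs and descends, so minus half its
    length is the ultrametric at the join up to a term in the image of [Phi]. *)
Definition ball_len v w : \bar R :=
  if is_foot v || is_foot w then +oo%E else (`|radius v - radius w|)%:E.

Lemma ball_len_sym v w : ball_len v w = ball_len w v.
Proof. by rewrite /ball_len orbC distrC. Qed.

Lemma ball_adj_radius v w : ball_adj v w -> radius v != radius w.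
Proof.
by case/orP=> /covers_proper/ball_proper_radius; case: ltgtP.
Qed.

Lemma ball_len_gt0 v w : ball_adj v w -> (0 < ball_len v w)%E.
Proof.
move=> /ball_adj_radius vw; rewrite /ball_len; case: ifP => _; first exact: ltry.
by rewrite lte_fin normr_gt0 subr_eq0.
Qed.

Definition ball_tree : metric_tree R :=
  MetricTree ball_adj_sym ball_adj_irr ball_adj_connected ball_adj_acyclic
    (fun v w _ => ball_len_sym v w) ball_len_gt0.

Lemma inner_ball (v : ball_tree) : inner v = ~~ is_foot (v : ball U).
Proof. by rewrite /inner /valence -valence_foot. Qed.

Fact ball_no2valent (v : ball_tree) : valence v != 2%N.
Proof.
have [vf|vf] := boolP (is_foot (v : ball U)).
  by move: vf; rewrite -valence_foot => /eqP E; rewrite /valence E.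
by have := not_foot_valence vf; rewrite /valence; case: #|_| => [|[|[|]]].
Qed.

Fact ball_not2 : #|ball_tree| != 2%N.
Proof.
have [w wf _] := foot_nbr o; have := not_foot_valence wf => H.
by rewrite neq_ltn (leq_trans H (max_card _)) orbT.
Qed.

Fact ball_legs (v w : ball_tree) : tadj v w ->
  tlen v w = +oo%E <-> valence v = 1%N \/ valence w = 1%N.
Proof.
move=> _; have vE (z : ball_tree) : (valence z = 1%N) <-> is_foot (z : ball U).
  by rewrite -valence_foot; split=> /eqP.
rewrite !vE /tlen /= /ball_len; case: ifP => [/orP //|/norP[vf wf]].
by split=> // -[]; [rewrite (negPf vf)|rewrite (negPf wf)].
Qed.

Definition ball_curve : abs_curve R := AbsCurve ball_no2valent ball_not2 ball_legs.

End BallTreeMetric.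

Section BallTreeDistance.
Variables (R : realType) (L : finType) (o : L) (U : rooted_ultrametric R o).
Hypothesis card_L : (3 <= #|L|)%N.
Implicit Types (a b x : L).
Implicit Types v w z : ball U.
Local Notation foot := (foot U).
Local Notation "a \in_ v" := (a \in val v) (at level 70).
Local Notation "v <=_ w" := (val v \subset val w) (at level 70).
Local Notation "v <_ w" := (val v \proper val w) (at level 70).
Local Notation C := (ball_curve U card_L).

(** The inner vertex at the leg [a]. For [a = o] it is the complement of [o] and lies below its
    foot; otherwise it lies above. *)
Definition root a : ball U := s2val (cid2 (foot_nbr U card_L a)).

Lemma root_not_foot a : ~~ is_foot (root a).
Proof. by rewrite /root; case: cid2. Qed.

Lemma foot_adj a : ball_adj (foot a) =1 pred1 (root a).
Proof. by rewrite /root; case: cid2 => w ? []. Qed.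

Lemma foot_covers a : a != o -> covers (foot a) (root a).
Proof. by rewrite /root; case: cid2 => w _ /= [H _] /negPf ao; rewrite ao in H. Qed.

Lemma root_covers : covers (root o) (foot o).
Proof. by rewrite /root; case: cid2 => w _ /=; rewrite eqxx => -[[]]. Qed.

Lemma root_set : val (root o) = [set~ o].
Proof. by rewrite /root; case: cid2 => w _ /=; rewrite eqxx => -[[]]. Qed.

(** A foot is either a singleton, which contains no smaller ball, or the whole space, which lies in
    no larger one. *)
Lemma not_foot_between v z w : v <=_ z -> z <=_ w -> ~~ is_foot v -> ~~ is_foot w ->
  ~~ is_foot z.
Proof.
move=> vz zw vf wf; apply/existsP => -[a /eqP zE].
have [ao|ao] := eqVneq a o.
  have := fintype.subsetP zw o; rewrite zE ao foot_root => /(_ isT).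
  by rewrite root_notin => /eqP wE; case/existsP: wf; exists o; rewrite wE.
case/existsP: vf; exists a; apply/eqP/val_inj/eqP.
rewrite finset.eqEsubset -{1}zE vz foot_set1 // finset.sub1set.
have := fintype.subsetP vz _ (mem_center v).
by rewrite zE foot_set1 // inE => /eqP <-; apply: mem_center.
Qed.

Lemma ball_walk_step v w : covers v w -> ~~ is_foot v -> ~~ is_foot w ->
  fine (@tlen R C v w) = radius v - radius w /\
  fine (@tlen R C w v) = radius v - radius w.
Proof.
move=> vw vf wf; have rwv := ball_proper_radius (covers_proper vw).
have E : fine (@tlen R C v w) = radius v - radius w.
  rewrite /= /ball_len (negPf vf) (negPf wf) /= ger0_norm //.
  by rewrite subr_ge0 ltW.
by split=> //; rewrite -E /= ball_len_sym.
Qed.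

(** The path through successive parents. The bound on its vertices serves to detect intersections in
    [ball_tdist]. *)
Lemma ascent v w : v <=_ w -> ~~ is_foot v -> ~~ is_foot w ->
  exists p : seq C, [/\ path (@tadj R C) v p, uniq ((v : C) :: p), last (v : C) p = w,
    forall z : ball U, ((z : C) \in (v : C) :: p) -> (v <=_ z)
    & @walk_length R C v p = radius v - radius w].
Proof.
move=> + + wf; have [n] := ubnP (#|val w| - #|val v|)%N.
elim: n v => // n IH v vn vw vf.
have [->|vnw] := eqVneq v w.
  exists [::]; split=> //= [z|]; first by rewrite inE => /eqP ->.
  by rewrite /walk_length big_nil subrr.
have pvw : v <_ w.
  by rewrite finset.properEneq vw andbT; apply: contra vnw => /eqP/val_inj ->.
have [u vu] := parent_ex (not_foot_neq o vf).
have uw := covers_min vu pvw.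
have uf : ~~ is_foot u by apply: not_foot_between uw vf wf; apply/proper_sub/covers_proper.
have [p [up uniqp lp sub len]] : exists p : seq C, [/\ path (@tadj R C) u p,
    uniq ((u : C) :: p), last (u : C) p = w,
    forall z : ball U, ((z : C) \in (u : C) :: p) -> (u <=_ z)
    & @walk_length R C u p = radius u - radius w].
  apply: IH => //; move: vn; have := proper_card (covers_proper vu).
  have := subset_leq_card uw.
  move: #|val v| #|val w| #|val u| => i j k; lia.
exists ((u : C) :: p); split=> //.
- by rewrite /= up andbT /ball_adj vu.
- rewrite cons_uniq uniqp andbT; apply/negP => /sub.
  by have := covers_proper vu; rewrite properE => /andP[_ /negPf ->].
- move=> z; rewrite inE => /orP[/eqP -> //|/sub uz].
  exact: fintype.subset_trans (proper_sub (covers_proper vu)) uz.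
by rewrite walk_length_cons (ball_walk_step vu vf uf).1 len addrA subrK.
Qed.

(** Built from the bottom, by appending [v] to the path to its parent. The start [w] is exempt from
    the strict bound, being the vertex shared with an ascent. *)
Lemma descent v w : v <=_ w -> ~~ is_foot v -> ~~ is_foot w ->
  exists p : seq C, [/\ path (@tadj R C) w p, uniq ((w : C) :: p), last (w : C) p = v,
    forall z : ball U, ((z : C) \in p) -> ((v <=_ z) && (z <_ w))
    & @walk_length R C w p = radius v - radius w].
Proof.
move=> + + wf; have [n] := ubnP (#|val w| - #|val v|)%N.
elim: n v => // n IH v vn vw vf.
have [->|vnw] := eqVneq v w.
  exists [::]; split=> //=.
  by rewrite /walk_length big_nil subrr.
have pvw : v <_ w.
  by rewrite finset.properEneq vw andbT; apply: contra vnw => /eqP/val_inj ->.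
have [u vu] := parent_ex (not_foot_neq o vf).
have uw := covers_min vu pvw.
have puv := covers_proper vu.
have uf : ~~ is_foot u by apply: not_foot_between uw vf wf; apply/proper_sub/covers_proper.
have [p [up uniqp lp sub len]] : exists p : seq C, [/\ path (@tadj R C) w p,
    uniq ((w : C) :: p), last (w : C) p = u,
    forall z : ball U, ((z : C) \in p) -> ((u <=_ z) && (z <_ w))
    & @walk_length R C w p = radius u - radius w].
  apply: IH => //; move: vn; have := proper_card puv.
  have := subset_leq_card uw.
  move: #|val v| #|val w| #|val u| => i j k; lia.
have nvp : (v : C) \notin (w : C) :: p.
  rewrite inE negb_or vnw; apply/negP => /sub/andP[uv _].
  by move: puv; rewrite properE uv andbF.
exists (rcons p (v : C)); split.
- by rewrite rcons_path up lp /= /ball_adj vu orbT.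
- by rewrite -rcons_cons rcons_uniq nvp.
- by rewrite last_rcons.
- move=> z; rewrite mem_rcons inE => /orP[/eqP ->|/sub/andP[uz ->]].
    by rewrite subxx.
  by rewrite andbT; exact: fintype.subset_trans (proper_sub puv) uz.
rewrite -cats1 walk_length_cat lp walk_length_cons (ball_walk_step vu vf uf).2 len.
by rewrite /walk_length big_nil addr0 addrC addrA subrK.
Qed.

(** Climb to the join [z] and descend. A vertex met twice would contain [v] and [w], hence [z],
    whereas the descent stays strictly below [z]. *)
Lemma ball_tdist v w z : v <=_ z -> w <=_ z ->
  (forall z' : ball U, v <=_ z' -> w <=_ z' -> z <=_ z') ->
  ~~ is_foot v -> ~~ is_foot w -> ~~ is_foot z ->
  @tdist R C v w = radius v + radius w - 2 * radius z.
Proof.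
move=> vz wz minz vf wf zf.
have [p [vp up lp subp lenp]] := ascent vz vf zf.
have [q [zq uq lq subq lenq]] := descent wz wf zf.
have := @tdist_path R C v (p ++ q); rewrite cat_path vp lp zq -cat_cons cat_uniq up.
have -> : ~~ has (in_mem^~ (mem ((v : C) :: p))) q.
  apply/hasPn => z' /subq/andP[wz' z'z]; apply/negP => /subp vz'.
  by move: z'z; rewrite properE minz ?andbF.
have -> : uniq q by case/andP: uq.
rewrite last_cat lp lq => /(_ isT isT) ->.
by rewrite walk_length_cat lp lenp lenq; ring.
Qed.

Lemma root_mkball a b : a != o -> a != b -> root a <=_ mkball U a b.
Proof.
move=> ao ab; apply: covers_min (foot_covers ao) _.
rewrite (ball_properP (mem_mkball U a a).1 (mem_mkball U a b).1) !radius_mkball.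
by rewrite um_self // eq_sym.
Qed.

Lemma mem_root a : a != o -> a \in_ root a.
Proof.
move=> ao; have := covers_proper (foot_covers ao); rewrite foot_set1 //.
by move/proper_sub; rewrite finset.sub1set.
Qed.

Lemma root_sub_body a : a != o -> root a <=_ root o.
Proof.
move=> ao; rewrite root_set; apply/fintype.subsetP => x xr; rewrite !inE.
by apply: in_foot_root xr; rewrite not_foot_neq ?root_not_foot.
Qed.

Lemma tdist_root a b : a != o -> b != o -> a != b ->
  @tdist R C (root a) (root b) = radius (root a) + radius (root b) - 2 * U a b.
Proof.
move=> ao bo ab; have [ma mb] := mem_mkball U a b.
have sa := root_mkball ao ab.
have sb : root b <=_ mkball U a b.
  rewrite eq_sym in ab; apply: fintype.subset_trans (root_mkball bo ab) _.
  rewrite (ball_nested (mem_mkball U b a).1 mb) !radius_mkball.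
  by rewrite [leRHS]um_sym.
rewrite -(radius_mkball U a b); apply: ball_tdist; rewrite ?root_not_foot //.
  move=> z az bz; rewrite (ball_nested ma) ?radius_mkball.
    apply: radius_le; first exact: (fintype.subsetP az _ (mem_root ao)).
    exact: (fintype.subsetP bz _ (mem_root bo)).
  exact: (fintype.subsetP az _ (mem_root ao)).
(* The join lies between [root a] and [root o], so it is no foot. *)
apply: (not_foot_between sa _ (root_not_foot a) (root_not_foot o)).
rewrite root_set; apply/fintype.subsetP => x; rewrite !inE => xr.
by apply: contraTneq xr => ->; rewrite -ltNge [U a o]um_sym um_root um_root_lt.
Qed.

Lemma tdist_root_body a : a != o ->
  @tdist R C (root a) (root o) = radius (root a) - radius (root o) /\
  @tdist R C (root o) (root a) = radius (root a) - radius (root o).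
Proof.
move=> ao; have s := root_sub_body ao.
by split; rewrite (ball_tdist (z := root o)) ?root_not_foot //; ring.
Qed.

End BallTreeDistance.

(** * The parametrization of the ball tree *)

Section BallTropicalCurve.
Variables (R : realType) (V : vectType R) (N : set V) (I J : finType).
Variables (Delta : J -> V) (i0 : I) (t0 : V).
Local Notation L := (I + J)%type.
Local Notation o := (inl i0 : L).
Variable U : rooted_ultrametric R o.
Hypothesis card_L : (3 <= #|{: L}|)%N.
Hypothesis Delta_sum : \sum_j Delta j = 0.
Hypothesis N_sum : forall P : pred J, N (\sum_(j | P j) Delta j).
Hypothesis N_opp : forall x, N x -> N (- x).
Implicit Types v w z : ball U.
Local Notation foot := (foot U).
Local Notation root := (root U card_L).
Local Notation "a \in_ v" := (a \in val v) (at level 70).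
Local Notation "v <=_ w" := (val v \subset val w) (at level 70).
Local Notation "v <_ w" := (val v \proper val w) (at level 70).
Local Notation C := (ball_curve U card_L).

(** Balancing forces this to be the direction of the edge above [v], pointing down to [v]. *)
Definition flow v : V := \sum_(j | inr j \in_ v) Delta j.

Lemma flow_children v : ~~ is_foot v -> \sum_(w | covers w v) flow w = flow v.
Proof.
move=> vf; rewrite /flow [RHS]big_mkcond /=.
under eq_bigr => w _ do rewrite big_mkcond /=.
rewrite exchange_big /=; apply: eq_bigr => j _.
case: ifP => [vj|vj]; last first.
  apply: big1 => w /covers_proper/proper_sub/fintype.subsetP wv.
  by case: ifP => // /wv; rewrite vj.
have [u uv uj] := child_ex vj (not_foot_neq (inr j) vf).
rewrite (bigD1 u) //= uj big1 ?addr0 // => w /andP[wv wu].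
case: ifP => // wj; case/eqP: wu; exact: child_unique wv uv wj uj.
Qed.

Definition ball_dir v w : V := if covers v w then - flow v else flow w.

(* The [min] is the radius of the smallest ball containing [v] and the foot of
   the leg [j]. *)
Definition ball_pos v : V :=
  t0 + \sum_j Num.min (radius v) (U (inr j) (center v)) *: Delta j.

(** For a leg inside [v] the minimum passes from the radius of [w] to that of [v]; for any other leg
    it is the same at both vertices. *)
Lemma ball_pos_covers v w : covers v w ->
  ball_pos v = ball_pos w + (radius v - radius w) *: flow v.
Proof.
move=> vw; have pvw := covers_proper vw.
have cw := fintype.subsetP (proper_sub pvw) _ (mem_center v).
rewrite /ball_pos -addrA; congr (_ + _).
rewrite /flow [X in _ = _ + _ *: X]big_mkcond scaler_sumr -big_split /=; apply: eq_bigr => j _.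
set u := U _ (center v); set u' := U _ (center w).
have uE : (inr j \in_ v) = (radius v <= u).
  by rewrite (mem_ballP _ (mem_center v)) um_sym.
have u'E : (inr j \in_ w) = (radius w <= u').
  by rewrite (mem_ballP _ (mem_center w)) um_sym.
have uwE : (inr j \in_ w) = (radius w <= u) by rewrite (mem_ballP _ cw) um_sym.
case: ifP => vj.
  have := fintype.subsetP (proper_sub pvw) _ vj; rewrite u'E => /min_idPl ->.
  by move: vj; rewrite uE => /min_idPl ->; rewrite -scalerDl addrC subrK.
rewrite scaler0 addr0; congr (_ *: _).
have uv : u < radius v by rewrite ltNge -uE vj.
rewrite (min_idPr (ltW uv)).
have [mc mj] := mem_mkball U (center v) (inr j).
(* The smallest ball joining [v] to the leg [j] is strictly larger than [v], hence contains the
   parent [w]. *)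
have vz : v <_ mkball U (center v) (inr j).
  by rewrite (ball_properP (mem_center v) mc) radius_mkball um_sym.
have wz := covers_min vw vz.
have wu : u <= radius w by rewrite /u um_sym -radius_mkball ball_subP.
have uu' : u <= u'.
  rewrite /u /u' um_sym -(radius_mkball U); apply: radius_le => //.
  exact: (fintype.subsetP wz _ (mem_center w)).
case: (leP (radius w) u') => wu'.
  by apply/eqP; rewrite eq_le wu -uwE u'E.
(* Here [j] is outside [w], and all points of [w] are equally far from it. *)
apply/eqP; rewrite eq_le uu' /=.
apply: (um_trans (lexx u')); apply: le_trans (ltW wu') _.
exact: radius_le (mem_center w) cw.
Qed.

Lemma ball_pos_affine (v w : C) : inner v -> inner w -> tadj v w ->
  ball_pos w = ball_pos v + fine (tlen v w) *: ball_dir v w.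
Proof.
rewrite !inner_ball => vf wf /orP[vw|wv].
  rewrite (ball_walk_step card_L vw vf wf).1 /ball_dir vw (ball_pos_covers vw).
  by rewrite scalerN addrK.
by rewrite (ball_walk_step card_L wv wf vf).2 /ball_dir (covers_asym wv) (ball_pos_covers wv).
Qed.

Lemma ball_dir_balanced (v : C) : inner v -> \sum_(w | tadj v w) ball_dir v w = 0.
Proof.
rewrite inner_ball => vf.
have [w vw] := parent_ex (not_foot_neq o vf).
rewrite (bigD1 (w : C)) /=; last by rewrite /ball_adj vw.
rewrite {1}/ball_dir vw -(flow_children vf) addrC; apply/eqP; rewrite subr_eq0.
apply/eqP; apply: eq_big => [z|z /andP[/orP[vz|zv] zw]].
- apply/andP/idP => [[/orP[vz|//] zw]|zv].
    by case/eqP: zw; exact: parent_unique vz vw.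
  by rewrite /ball_adj zv orbT; split=> //; apply: contraTneq zv => ->;
     rewrite (covers_asym vw).
- by case/eqP: zw; exact: parent_unique vz vw.
- by rewrite /ball_dir (covers_asym zv).
Qed.

Lemma flow_int v : N (flow v).
Proof. exact: N_sum. Qed.

(** The foot of [o] is above its root, so this direction is minus the sum of all degrees. Any other
    foot is a singleton, whose flow is its own degree, or 0 for a leg of [I]. *)
Lemma ball_dir_foot (a : L) :
  ball_dir (root a) (foot a) = if a is inr j then Delta j else 0.
Proof.
have [ao|ao] := eqVneq a o.
  rewrite ao /ball_dir root_covers /flow root_set.
  rewrite (eq_bigl predT) ?Delta_sum ?oppr0 // => j.
  by rewrite !inE.
rewrite /ball_dir (covers_asym (foot_covers U card_L ao)) /flow foot_set1 //.
case: a ao => [i|j] ao; first by apply: big_pred0 => j; rewrite inE.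
by rewrite (big_pred1 j) // => j'; rewrite inE.
Qed.

Definition ball_trop_curve : trop_curve N I Delta.
Proof.
apply: (@TropCurve R V N I J Delta C (fun a => root a : C) (fun a => foot a : C)
  _ _ _ _ ball_pos ball_dir _ ball_pos_affine ball_dir_balanced).
- by move=> a; rewrite tadj_sym /= foot_adj /=.
- by move=> a; rewrite inner_ball root_not_foot.
- exact: foot_inj.
- move=> v; have vf : (valence v == 1%N) = is_foot (v : ball U).
    exact: valence_foot.
  split=> [/eqP|[a av]].
    by rewrite vf => /existsP[a /eqP ->]; exists a.
  by apply/eqP; rewrite vf; apply/existsP; exists a; rewrite -av.
- move=> v w _ _; rewrite /ball_dir; case: ifP => _; last exact: flow_int.
  exact/N_opp/flow_int.
- by move=> i; rewrite ball_dir_foot.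
- by move=> j; rewrite ball_dir_foot.
Defined.

(** All points other than [o] lie in [root o], so every minimum there is its radius, and the degrees
    sum to 0. *)
Lemma ball_tev_root : tev ball_trop_curve i0 = t0.
Proof.
rewrite /tev /= /ball_pos.
rewrite (eq_bigr (fun j => radius (root o) *: Delta j)).
  by rewrite -scaler_sumr Delta_sum scaler0 addr0.
move=> j _; congr (_ *: _); apply/min_idPl; rewrite um_sym.
by apply: radius_le; [exact: mem_center|rewrite root_set !inE].
Qed.

Lemma ball_tpl (w : {ffun dpairs L -> R}) :
  (forall d, w d = if ((val d).1 == o) || ((val d).2 == o) then 0
                   else U (val d).1 (val d).2) ->
  tpl ball_trop_curve = \pi_(pl_trop R L) w.
Proof.
move=> wE; apply/eqmodP/asboolP.
pose r a := radius (root a).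
(* The half radii cancel those in the distances. The sign at [o] is opposite because [root o] is
   itself the top of every path that ends there. *)
exists [ffun a => if a == o then - r o / 2 else r a / 2]; apply/ffunP => -[[a b] /= ab].
rewrite !ffunE wE /=; have [ao|ao] := eqVneq a o; have [bo|bo] := eqVneq b o.
- by rewrite ao bo eqxx in ab.
- by rewrite ao (tdist_root_body U card_L bo).2 /r /=; field.
- by rewrite bo (tdist_root_body U card_L ao).1 /r /=; field.
by rewrite /= tdist_root // /r; field.
Qed.

End BallTropicalCurve.

(** * Tropicalization *)

Section LatticeDuality.
Variables (R : realType) (V : vectType R) (N : set V).
Hypothesis latN : is_lattice N.

Lemma lattice0 : N 0.
Proof.
have [n [b [_ ->]]] := latN; exists (fun=> 0).
by rewrite big1 // => k _; rewrite mulr0z.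
Qed.

Lemma lattice_opp x : N x -> N (- x).
Proof.
have [n [b [_ NE]]] := latN; rewrite !NE => -[c ->]; exists (fun k => - c k).
by rewrite -sumrN; apply: eq_bigr => k _; rewrite mulrNz.
Qed.

Lemma lattice_add x y : N x -> N y -> N (x + y).
Proof.
have [n [b [_ NE]]] := latN; rewrite !NE => -[c ->] [d ->].
exists (fun k => c k + d k).
by rewrite -big_split; apply: eq_bigr => k _; rewrite mulrzDr.
Qed.

Lemma lattice_muln x k : N x -> N (x *+ k).
Proof.
move=> Nx; elim: k => [|k IH]; first by rewrite mulr0n; exact: lattice0.
by rewrite mulrS; exact: lattice_add.
Qed.

Lemma char_sumE (T : Type) (s : seq T) (P : pred T) (m : T -> charlat N) x :
  ((\sum_(t <- s | P t) m t) x : R) = \sum_(t <- s | P t) m t x.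
Proof.
by elim/big_rec2: _ => [|t y z _ <-]; rewrite ?char0E ?charDE.
Qed.

(** The coordinate forms of a lattice basis generate the characters, so their values under [chi] are
    the coordinates of [t]. This yields the position of the leg [i0]. *)
Lemma charlat_hom (chi : charlat N -> R) :
  (forall m n, chi (m + n) = chi m + chi n) -> exists t, tpoint t = chi.
Proof.
move=> chiD; have [n [b [bV NE]]] := latN.
have fb := basis_free bV.
have chi0 : chi 0 = 0.
  by apply: (addrI (chi 0)); rewrite -chiD !addr0.
have chiN m : chi (- m) = - chi m.
  by apply/eqP; rewrite -addr_eq0 -chiD addNr chi0.
have chiMz m (k : int) : chi (m *~ k) = chi m *~ k.
  have chiMn (a : nat) : chi (m *+ a) = chi m *+ a.
    by elim: a => [|a IH]; rewrite ?mulr0n // !mulrS chiD IH.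
  by case: k => a; rewrite ?NegzE ?mulrNz ?chiN -?pmulrn chiMn.
have e_int k : linfun (coord b k : V -> R^o) \in integral_forms N.
  apply/asboolP => x /NE[c ->]; rewrite lfunE linear_sum /=.
  rewrite (eq_bigr (fun l => ((l == k)%:R * (c l)%:~R : R))).
    by rewrite rpred_sum // => l _; case: eqP => _; rewrite ?mul1r ?mul0r ?rpred0 ?intr_int.
  by move=> l _; rewrite raddfMz /= (tnth_nth 0) coord_free // mulrzr.
pose e k := Charlat (e_int k).
exists (\sum_(k < n) chi (e k) *: tnth b k); apply: funext => m.
have b_lat k : N (tnth b k).
  apply/NE; exists (fun l => (l == k)%:R).
  rewrite (bigD1 k) //= eqxx mulr1z big1 ?addr0 // => l /negPf ->.
  by rewrite mulr0z.
pose z k : int := Num.floor (m (tnth b k) : R).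
have zE k : (z k)%:~R = m (tnth b k) :> R.
  apply/eqP; rewrite -intrEfloor; have /asboolP := char_int m.
  by apply; exact: b_lat.
have mE : m = \sum_k e k *~ z k.
  apply/val_inj/lfunP => x /=; rewrite char_sumE.
  rewrite [in LHS](coord_basis bV (memvf x)) linear_sum; apply: eq_bigr => k _.
  rewrite charMzE /= lfunE /= linearZ /= -(tnth_nth 0) -zE.
  by rewrite -[RHS]mulrzr.
rewrite /tpoint linear_sum [in RHS]mE (big_morph chi chiD chi0).
by apply: eq_bigr => k _; rewrite linearZ /= -zE chiMz -[RHS]mulrzr.
Qed.

End LatticeDuality.

Section Valuations.
Variables (K : fieldType) (R : realType) (nu : valuation K R).

Lemma val1 : nu 1 = 0.
Proof.
apply: (addrI (nu 1)).
by rewrite -[in LHS](Defs.valM nu) ?oner_eq0 // mulr1 addr0.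
Qed.

Lemma valN x : nu (- x) = nu x.
Proof.
have [->|x0] := eqVneq x 0; first by rewrite oppr0.
have N1 : (-1 : K) != 0 by rewrite oppr_eq0 oner_eq0.
have : nu (-1) + nu (-1) = 0 by rewrite -(Defs.valM nu) // mulrNN mulr1 val1.
move=> H; rewrite -mulN1r (Defs.valM nu) //; lra.
Qed.

Lemma valV x : x != 0 -> nu x^-1 = - nu x.
Proof.
move=> x0; apply/eqP.
by rewrite -addr_eq0 -(Defs.valM nu) ?invr_eq0 // mulVf // val1.
Qed.

Lemma valX (x : K) (k : int) : x != 0 -> nu (x ^ k) = nu x *~ k.
Proof.
move=> x0; have nX (a : nat) : nu (x ^+ a) = nu x *+ a.
  elim: a => [|a IH]; first by rewrite expr0 val1 mulr0n.
  by rewrite exprS (Defs.valM nu) ?expf_neq0 // IH mulrS.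
case: k => a; first exact: nX.
by rewrite NegzE mulrNz -exprnN valV ?expf_neq0 // nX pmulrn.
Qed.

Lemma val_prod (T : Type) (s : seq T) (F : T -> K) : (forall t, F t != 0) ->
  nu (\prod_(t <- s) F t) = \sum_(t <- s) nu (F t).
Proof.
move=> F0; elim: s => [|t s IH]; first by rewrite !big_nil val1.
have P0 : \prod_(u <- s) F u != 0.
  by elim: s {IH} => [|u s IH]; rewrite ?big_nil ?oner_eq0 // big_cons mulf_neq0 ?F0.
by rewrite !big_cons (Defs.valM nu) ?F0 // IH.
Qed.

End Valuations.

(** * From the four-point condition to a rooted ultrametric *)

Section BracketUltrametric.
Variables (R : realType) (L : finType) (o : L) (w : L -> L -> R).
Hypothesis w_sym : forall a b, w a b = w b a.
Hypothesis w_four : forall a b c d, uniq [:: a; b; c; d] ->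
  Num.min (w a b + w c d) (w b c + w a d) <= w a c + w b d.

(* Rescaling homogeneous coordinates so that all brackets with [o] have valuation
   0 makes the four-point condition with [o] an ultrametric inequality. *)
Definition gromov a b : R := w a b - w a o - w b o.
(** A finite stand-in for infinity, used with a plus sign on the diagonal and with a minus sign at
    [o]. The summand 1 makes the comparisons strict. *)
Definition gromov_bound : R := 1 + \sum_(ab : L * L) `|gromov ab.1 ab.2|.
Definition gromov_um a b : R :=
  if (a == o) || (b == o) then - gromov_bound
  else if a == b then gromov_bound else gromov a b.

Lemma gromov_lt a b : - gromov_bound < gromov a b < gromov_bound.
Proof.
rewrite -ltr_norml /gromov_bound (bigD1 (a, b)) //= addrCA ltrDl.
by rewrite ltr_pwDl ?ltr01 // sumr_ge0.
Qed.

Lemma gromov_bound_gt0 : 0 < gromov_bound.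
Proof. by rewrite ltr_pwDl ?ltr01 // sumr_ge0. Qed.

Lemma gromov_um_le a b : - gromov_bound <= gromov_um a b <= gromov_bound.
Proof.
have := gromov_bound_gt0; have := gromov_lt a b.
rewrite /gromov_um; case: ifP => _; last case: ifP => _; lra.
Qed.

Fact gromov_um_sym a b : gromov_um a b = gromov_um b a.
Proof.
rewrite /gromov_um orbC [b == a]eq_sym /gromov w_sym.
by case: ifP => // _; case: ifP => // _; rewrite addrAC.
Qed.

Fact gromov_um_trans r b a c :
  r <= gromov_um a b -> r <= gromov_um b c -> r <= gromov_um a c.
Proof.
have := gromov_um_le a c; rewrite /gromov_um.
have [->|ao] := eqVneq a o; first by [].
have [->|co] := eqVneq c o; first by rewrite !orbT.
have [->|bo] := eqVneq b o; first by move=> /andP[+ _] /le_trans H _; apply: H.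
have [->|ab] := eqVneq a b; first by [].
have [<-|bc] := eqVneq b c; first by rewrite (negPf ab).
have [->|ac] /= := eqVneq a c.
  move=> _ H _; apply: le_trans H _.
  by have /andP[_ /ltW] := gromov_lt c b.
(* With [o] as fourth point, subtracting [w a o + w b o + w c o] from both sides leaves the
   ultrametric inequality. *)
have := @w_four a b c o; rewrite /gromov /= !inE !negb_or ab ac ao bc bo co.
by move=> /(_ isT) + _; rewrite ge_min => /orP[] H H1 H2; lra.
Qed.

Fact gromov_um_self a b : a != o -> b != a -> gromov_um a b < gromov_um a a.
Proof.
move=> ao ba; rewrite /gromov_um (negPf ao) eqxx /= [a == b]eq_sym (negPf ba).
case: ifP => _; first by have := gromov_bound_gt0; lra.
by case/andP: (gromov_lt a b).
Qed.

Fact gromov_um_root b : gromov_um o b = gromov_um o o.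
Proof. by rewrite /gromov_um eqxx. Qed.

Fact gromov_um_root_lt a b : a != o -> b != o -> gromov_um o o < gromov_um a b.
Proof.
move=> ao bo; rewrite /gromov_um eqxx (negPf ao) (negPf bo) /=.
case: ifP => _; first by have := gromov_bound_gt0; lra.
by case/andP: (gromov_lt a b).
Qed.

Definition gromov_ultrametric : rooted_ultrametric R o :=
  RootedUltrametric gromov_um_sym gromov_um_trans gromov_um_self gromov_um_root
    gromov_um_root_lt.

End BracketUltrametric.

Section Tropicalization.
Variables (R : realType) (K : closedFieldType) (nu : valuation K R).
Variables (V : vectType R) (N : set V) (S : ray_fan N).
Variables (I J : finType) (c : tangency S J).
Local Notation L := (I + J)%type.

Lemma bracketC (x y : hcoord K) : bracket x y = - bracket y x.
Proof. by rewrite /bracket; ring. Qed.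

(** The three-term Pluecker relation, read through the valuation. *)
Lemma bracket_four_point (x y z w : hcoord K) :
  bracket x y != 0 -> bracket z w != 0 -> bracket y z != 0 -> bracket x w != 0 ->
  bracket x z != 0 -> bracket y w != 0 ->
  Num.min (nu (bracket x y) + nu (bracket z w)) (nu (bracket y z) + nu (bracket x w))
    <= nu (bracket x z) + nu (bracket y w).
Proof.
move=> xy zw yz xw xz yw; rewrite -!(Defs.valM nu) //.
have -> : bracket x z * bracket y w =
    bracket x y * bracket z w + bracket y z * bracket x w.
  by rewrite /bracket; ring.
apply: Defs.valD; rewrite ?mulf_neq0 //.
have -> : bracket x y * bracket z w + bracket y z * bracket x w =
    bracket x z * bracket y w by rewrite /bracket; ring.
by rewrite mulf_neq0.
Qed.

Lemma trop_curve_ex (latN : is_lattice N) (i0 : I) (card_L0 : (3 <= #|{: L}|)%N)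
    (C : alg_curve K I c) :
  exists D : trop_curve N I (tdegree c), tembed i0 D = embed_trop nu (embed i0 C).
Proof.
pose o : L := inl i0.
pose w a b := nu (bracket (hrep (mark C a)) (hrep (mark C b))).
have b0 a b : a != b -> bracket (hrep (mark C a)) (hrep (mark C b)) != 0.
  by move=> ab; apply: bracket_neq0; rewrite (inj_eq (@mark_inj _ _ _ _ _ _ _ _ C)).
have wC a b : w a b = w b a by rewrite /w bracketC valN.
have w4 a b d e : uniq [:: a; b; d; e] ->
    Num.min (w a b + w d e) (w b d + w a e) <= w a d + w b e.
  rewrite /= !inE !negb_or => /and4P[/and3P[ab ad ae] /andP[bd be] de _].
  by apply: bracket_four_point; apply: b0.
pose U := gromov_ultrametric o wC w4.
have NDelta j : N (tdegree c j).
  by apply: lattice_muln => //; case: (ray_gen_prim (tc_ray c j)).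
have N_sum (P : pred J) : N (\sum_(j | P j) tdegree c j).
  by apply: big_ind => [||j _]; [exact: lattice0|exact: lattice_add|exact: NDelta].
have [t0 t0E] : exists t0, tpoint t0 = torus_trop nu (ev C i0).
  apply: charlat_hom => // m n; rewrite /torus_trop torusD (Defs.valM nu) //;
  exact: torus_neq0.
exists (ball_trop_curve t0 U card_L0 (tdegree_sum c) N_sum (lattice_opp latN)).
rewrite /tembed ball_tev_root /embed_trop /= t0E; congr (_, _).
pose u : {ffun dpairs L -> R} := [ffun d => if ((val d).1 == o) || ((val d).2 == o)
  then 0 else U (val d).1 (val d).2].
rewrite (@ball_tpl _ _ _ _ _ _ _ _ _ _ _ _ _ u); last by move=> d; rewrite ffunE.
rewrite pl_torus_tropE; apply/eqmodP/asboolP.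
(* This undoes the normalization in [gromov] and restores the brackets with [o], which [u] sets to
   0. *)
exists [ffun a => if a == o then 0 else w a o]; apply/ffunP => -[[a b] /= ab].
rewrite !ffunE /= -/(w a b) /gromov_um (negPf ab).
have [ao|ao] := eqVneq a o; have [bo|bo] := eqVneq b o => /=.
- by rewrite ao bo eqxx in ab.
- by rewrite ao !add0r wC.
- by rewrite bo addr0 add0r.
by rewrite /gromov; ring.
Qed.

(** The valuation of [ev_ratio] matches [tev_sub]. The coordinates agree only up to [Phi x], but
    [x (inr j)] cancels in each difference, and [x (inl i) - x (inl i0)] is multiplied by the sum of
    the degrees, which is 0. *)
Lemma trop_ev (i0 i : I) (C : alg_curve K I c) (D : trop_curve N I (tdegree c)) :
  tembed i0 D = embed_trop nu (embed i0 C) ->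
  tpoint (tev D i) = torus_trop nu (ev C i) :> (charlat N -> R).
Proof.
rewrite /tembed /embed_trop /= pl_torus_tropE => -[/eqmodP/asboolP[x xE] ev0].
apply: funext => m; rewrite /torus_trop (ev_ratio C i0 i).
have b0 j k : bracket (hrep (mark C (inr j))) (hrep (mark C (inl k))) != 0.
  by apply: bracket_neq0; rewrite (inj_eq (@mark_inj _ _ _ _ _ _ _ _ C)).
pose b k j := bracket (hrep (mark C (inr j))) (hrep (mark C (inl k))).
have bE k j : nu (b k j) =
    - tdist (leg_root D (inr j)) (leg_root D (inl k)) / 2 + (x (inr j) + x (inl k)).
  by have /ffunP/(_ (end_mark_pair j k)) := xE; rewrite !ffunE.
have r0 j : b i j / b i0 j != 0 by rewrite mulf_neq0 ?invr_eq0 ?b0.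
rewrite (Defs.valM nu) ?torus_neq0 //; last first.
  by apply/prodf_neq0 => j _; rewrite expfz_neq0 //; exact: r0.
have -> : nu (ev C i0 m) = m (tev D i0) by have := congr1 (@^~ m) ev0.
rewrite val_prod => [|j]; last by rewrite expfz_neq0 //; exact: r0.
apply/eqP; rewrite addrC -subr_eq; apply/eqP.
rewrite /tpoint (tev_sub (tdegree_sum c) D m i0 i).
have mD : \sum_j (m (tdegree c j) : R) * (x (inl i) - x (inl i0)) = 0.
  by rewrite -mulr_suml -(raddf_sum (char_form m)) tdegree_sum raddf0 mul0r.
rewrite -[LHS]addr0 -[X in _ + X = _]mD -big_split /=; apply: eq_bigr => j _.
rewrite valX; last exact: r0.
rewrite (Defs.valM nu) ?invr_eq0 ?b0 // valV ?b0 //.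
rewrite !bE -[RHS]mulrzl pairingE; ring.
Qed.

End Tropicalization.

Theorem corollary5p2 (R : realType) (K : closedFieldType)
    (charK0 : [pchar K] =i pred0) (nu : valuation K R)
    (V : vectType R) (N : set V) (latN : is_lattice N) (S : ray_fan N)
    (I J : finType) (c : tangency S J) (i0 : I)
    (card_L0 : (3 <= #|{: I + J}|)%N) :
  (forall (i : I) (C : alg_curve K I c),
     (exists D : trop_curve N I (tdegree c),
        tembed i0 D = embed_trop nu (embed i0 C)) /\
     (forall D : trop_curve N I (tdegree c),
        tembed i0 D = embed_trop nu (embed i0 C) ->
        tpoint (tev D i) = torus_trop nu (ev C i) :> (charlat N -> R))) /\
  (forall i : I,
     exists phi : pl_torus K (I + J)%type * torus_pt K N -> torus_pt K N,
       is_torus_morphism phi /\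
       forall C : alg_curve K I c, phi (embed i0 C) = ev C i).
Proof.
split=> [i C|i]; first by split; [exact: trop_curve_ex|exact: trop_ev].
by exists (ev_ext c i0 i); split; [exact: ev_ext_morphism|exact: ev_ext_embed].
Qed.
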